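(* Let $s\geq 1$ be an integer and $k=2s$. For $1\leq i\leq s$ let $P_{i}(X)\in\mathbb{Z}[X]$ be a polynomial with integral coefficients in one variable of degree $d_{i}\geq 1$. Let $d:=\min_{1\leq i\leq s}d_{i}$ and $d^{\prime}:=\max_{1\leq i\leq s}d_{i}$. Define $$M=\left\{(x_{1},x_{2},\ldots,x_{s},P_{1}(x_{1}),\ldots,P_{s}(x_{s}))\in\mathbb{R}^{k}:(x_{1},\ldots,x_{s})\in\mathbb{R}^{s}\right\}.$$ Then for every $\lambda>\max\{d^{\prime}-1,1\}$, $$\mathscr{H}^{s}_{d^{\prime}\lambda+d^{\prime}-1}\subseteq\Pi_{s}(\mathscr{H}^{k}_{\lambda}\cap M)\subseteq\mathscr{H}^{s}_{d\lambda+d-1},$$ and hence $$\frac{s+1}{d^{\prime}(\lambda+1)}\leq\dim(\mathscr{H}^{k}_{\lambda}\cap M)\leq\frac{s+1}{d(\lambda+1)}.$$ In particular, if $d^{\prime}=d$, that is, all of the polynomials have the same degree, then for every $\lambda>\max\{d-1,1\}$, $$\Pi_{s}(\mathscr{H}^{k}_{\lambda}\cap M)=\mathscr{H}^{s}_{d\lambda+d-1}\qquad\text{and}\qquad\dim(\mathscr{H}^{k}_{\lambda}\cap M)=\frac{s+1}{d(\lambda+1)}.$$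
   Context: $\dim$ denotes Hausdorff dimension. For a real number $x$, $\Vert x\Vert$ denotes the distance of $x$ to the nearest integer. For an integer $m\geq 1$ and a real parameter $\lambda>0$, $\mathscr{H}^{m}_{\lambda}$ is the set of $(\zeta_{1},\ldots,\zeta_{m})\in\mathbb{R}^{m}$ such that for every fixed $\epsilon>0$ the estimate $\max_{1\leq j\leq m}\Vert q\zeta_{j}\Vert\leq q^{-\lambda+\epsilon}$ has arbitrarily large (positive) integer solutions $q$. $\Pi_{s}:\mathbb{R}^{k}\to\mathbb{R}^{s}$ is the projection onto the first $s$ coordinates. *)

(* Defs.v *)
From HB Require Import structures.
From mathcomp Require Import all_boot all_order all_algebra.
From mathcomp Require Import all_classical all_reals all_analysis.
Set Implicit Arguments.
Unset Strict Implicit.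
Unset Printing Implicit Defensive.
Import Order.TTheory GRing.Theory Num.Theory.
Import numFieldNormedType.Exports.
Local Open Scope classical_set_scope.
Local Open Scope ring_scope.

Section HausdorffDimension.
Context {R : realType} {V : normedModType R}.
Implicit Types (A U : set V) (t delta : R).
Local Open Scope ereal_scope.

(* -oo when U is empty *)
Definition diam U : \bar R :=
  ereal_sup [set `|p.1 - p.2|%:E | p in U `*` U].

(* The test on set0 makes the empty set weigh 0 also for t = 0, while a
   singleton then weighs 0 `^ 0 = 1. *)
Definition diam_pow t U : \bar R :=
  if U == set0 then 0 else poweR (diam U) t.

Definition hausdorff_content t delta A : \bar R :=
  ereal_inf [set \sum_(0 <= i <oo) diam_pow t (F i) |
    F in [set F : nat -> set V |
            A `<=` \bigcup_i F i /\ forall i, diam (F i) <= delta%:E]].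

Definition hausdorff_measure t A : \bar R :=
  ereal_sup [set hausdorff_content t delta A | delta in [set e : R | (0 < e)%R]].

Definition hausdorff_dim A : \bar R :=
  ereal_inf [set t%:E | t in [set t : R | (0 <= t)%R /\ hausdorff_measure t A = 0]].

End HausdorffDimension.

Section DiophantineApproximation.
Context {R : realType}.

Definition dist_int (x : R) : R := inf [set `|x - n%:~R| | n in [set: int]].

(* The big maximum starts from 0, which is harmless as distances are
   nonnegative.
   The points of R^m are row vectors. Their norm, hence the metric used in
   [hausdorff_dim], is the maximum norm; it is bi-Lipschitz equivalent to the
   Euclidean one, so the dimension is the usual one. *)
Definition approx_set (m : nat) (lambda : R) : set 'rV[R]_m :=
  [set zeta | forall eps : R, 0 < eps ->
    forall N : nat, exists q : nat, [/\ (0 < q)%N, (N <= q)%N &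
      \big[Num.max/0]_(j < m) dist_int (q%:R * zeta 0 j)
        <= q%:R `^ (- lambda + eps)]].

Definition poly_manifold (s : nat) (P : 'I_s -> {poly int}) :
    set 'rV[R]_(s + s) :=
  [set row_mx x (\row_i (map_poly intr (P i)).[x 0 i]) | x in [set: 'rV[R]_s]].

(* The projection of R^(s + t) onto the first s coordinates. *)
Definition proj_first (s t : nat) (z : 'rV[R]_(s + t)) : 'rV[R]_s := lsubmx z.

End DiophantineApproximation.

Arguments approx_set {R} m lambda.
Arguments poly_manifold R {s} P.

Definition degree (p : {poly int}) : nat := (size p).-1.

Definition max_degree (s : nat) (P : 'I_s -> {poly int}) : nat :=
  \max_(i < s) degree (P i).

(* Since the neutral value is the maximum, this is the minimum of the degrees
   as soon as 0 < s. *)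
Definition min_degree (s : nat) (P : 'I_s -> {poly int}) : nat :=
  \big[minn/max_degree P]_(i < s) degree (P i).

(* Main.v *)
Require Import Defs.
From HB Require Import structures.
From mathcomp Require Import all_boot all_order all_algebra.
From mathcomp Require Import all_classical all_reals all_analysis.
From mathcomp Require Import zify ring lra.
Import Order.TTheory GRing.Theory Num.Theory.
Import numFieldNormedType.Exports.
Local Open Scope ring_scope.
Set Implicit Arguments.
Unset Strict Implicit.
Unset Printing Implicit Defensive.

(** Let [G x] be the point of the manifold above [x], and for [n = d] or [n = d']
    let [tau n = n * lambda + n - 1], so that [tau n + 1 = n * (lambda + 1)].

    _The inclusions._ If [p / q] is within [q ^ - (tau d' + 1)] of [x], then the
    multiplier [q ^ d'] brings [G x] close to integer points, because the numbers
    [q ^ d' * P_i (p_i / q)] are integers ([approx_graph]). Conversely, let [q * G x]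
    be within [q ^ - lambda] of an integer point, and let [p_i] be the integer
    closest to [q * x_i]. Then [q * P_i (p_i / q)] is so close to an integer that,
    being a fraction of denominator at most [q ^ (d_i - 1)] and because of
    [lambda > d_i - 1], it is an integer. This forces the reduced denominator [b_i] of
    [p_i / q] to satisfy [b_i ^ d_i %| q * c_i ^ d_i], with [c_i] the leading
    coefficient ([denom_dvd]). The least common multiple [Q] of the [b_i] is
    therefore at most a constant times [q ^ (1 / d)], and this smaller multiplier
    approximates [x] with exponent [tau d] ([common_denominator],
    [approx_graph_inv]).

    _The upper bound of the dimension_ comes from the obvious covering of
    [approx_set s tau] by balls around rational points, transported by [G], which is
    Lipschitz with a constant growing polynomially ([hausdorff_dim_le]).

    _The lower bound_ is that of the theorem of Jarnik and Besicovitch,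
    [(s + 1) / (tau + 1) <= dim (approx_set s tau)], since the projection
    decreases distances ([hausdorff_dim_ge]). It amounts to this: sets [U i] with
    [\sum_i (diam (U i)) ^ t] small and [t < (s + 1) / (tau + 1)] cannot cover
    [approx_set s tau]. A point outside of them is the common point of nested balls
    [B_n] centred at rational points, of radius about the power [- (tau + 1)] of their
    denominators, chosen so that the sets meeting [B_n] have a total weight that is
    small compared with the [t]-th power of the radius of [B_n] ([jarnik_avoid]). The next
    ball exists by counting ([light_child]), provided that each ball contains
    about as many well separated rational points of a given height as its volume
    predicts; these are produced by Dirichlet's theorem at the points of a grid
    ([separated_rationals]). *)

(** * Distance to the integers, counting, and Dirichlet's theorem *)

(** The infimum defining [dist_int] is attained, at the integer part of
    [x + 1 / 2]. This lets every approximation be handled through explicit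
    integers. *)
Lemma dist_int_leP (R : realType) (x delta : R) :
  dist_int x <= delta <-> exists p : int, `|x - p%:~R| <= delta.
Proof.
split=> [xd|[p]]; last first.
  apply: le_trans; apply: ge_inf; last by exists p.
  by exists 0 => _ [n _ <-].
pose p := Num.floor (x + 1 / 2); exists p; apply: le_trans xd.
apply: lb_le_inf; first by exists `|x - 0%:~R|; exists 0.
move=> _ [n _ <-].
have /andP[pl pu] := floor_itv (x + 1 / 2); rewrite -/p intrD /= in pl pu.
have [->//|np] := eqVneq n p.
have : (n + 1 <= p) || (p + 1 <= n) by lia.
rewrite -!(ler_int R) !intrD => /orP[] h; rewrite ler_norml;
  have := ler_norm (x - n%:~R); have := ler_norm (- (x - n%:~R));
  rewrite normrN; lra.
Qed.

Lemma approx_setP (R : realType) (m : nat) (lambda : R) (x : 'rV[R]_m) :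
  approx_set m lambda x <->
  forall eps : R, 0 < eps -> forall N : nat, exists q : nat,
    [/\ (0 < q)%N, (N <= q)%N & forall j, exists p : int,
      `|q%:R * x 0 j - p%:~R| <= q%:R `^ (- lambda + eps)].
Proof.
split=> h eps eps0 N; have [q [q0 Nq hq]] := h eps eps0 N;
  exists q; split=> //.
  move=> j; apply/dist_int_leP; apply: le_trans hq.
  by rewrite (bigD1 j) //= le_max lexx.
apply/bigmax_leP; split; first exact: powR_ge0.
by move=> j _; apply/dist_int_leP.
Qed.

Section Counting.
Context {R : realType}.

(** All counts of rational points and of grid points go through this bound:
    integers in a window of length [w] number at most [w + 1]. *)
Lemma card_le_fibers (T : finType) (A : {set T}) (f : T -> int) (w : R) (k : nat) :
  0 <= w ->
  {in A &, forall x y, (f y - f x)%:~R <= w} ->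
  (forall v, (#|[set y in A | f y == v]| <= k)%N) ->
  #|A|%:R <= (w + 1) * k%:R.
Proof.
move=> w0 Aw Ak.
have [->|[a aA]] := set_0Vmem A.
  by rewrite cards0 mulr_ge0 // addr_ge0.
have [x0 x0A fmin] : exists2 x0, x0 \in A & {in A, forall y, f x0 <= f y}.
  by case: (arg_minP f aA) => x0 ? ?; exists x0.
pose W := Num.truncn w.
pose g x : 'I_W.+1 := inord `|f x - f x0|%N.
have gE y : y \in A -> (g y : nat) = `|f y - f x0|%N.
  move=> yA; rewrite inordK // ltnS truncn_ge_nat //.
  have := Aw _ _ x0A yA; have := fmin _ yA => fy.
  by rewrite -[(f y - f x0)]gez0_abs ?subr_ge0.
have : (#|A| <= W.+1 * k)%N.
  rewrite -sum1_card (partition_big g predT) //=.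
  rewrite -[X in (_ <= X * _)%N]card_ord -sum_nat_const; apply: leq_sum => v _.
  apply: leq_trans (Ak (f x0 + v%:Z)); rewrite sum1dep_card; apply: subset_leq_card.
  apply/fintype.subsetP => y; rewrite !inE => /andP[yA /eqP <-].
  rewrite yA /= gE //; have := fmin _ yA; lia.
rewrite -(ler_nat R) natrM => /le_trans; apply; rewrite ler_wpM2r //.
by rewrite -natr1 lerD2r truncn_le.
Qed.

Lemma card_le_window (T : finType) (A : {set T}) (f : T -> int) (w : R) :
  0 <= w -> {in A &, injective f} ->
  {in A &, forall x y, (f y - f x)%:~R <= w} ->
  #|A|%:R <= w + 1.
Proof.
move=> w0 fI Aw; rewrite -[leRHS]mulr1; apply: (card_le_fibers (k := 1%N) w0 Aw) => v.
have [->|[y]] := set_0Vmem [set y in A | f y == v]; first by rewrite cards0.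
rewrite inE => /andP[yA /eqP fy].
rewrite -(cards1 y); apply: subset_leq_card; apply/fintype.subsetP => z.
by rewrite !inE => /andP[zA /eqP fz]; apply/eqP/fI => //; rewrite fy fz.
Qed.

(** Along an arithmetic progression of step [beta], about [n * beta] integers are
    passed, and each of them has about [2 * delta / beta] terms of the
    progression within [delta]. *)
Lemma card_near_int (theta beta delta : R) (n : nat) (A : {set 'I_n}) :
  0 < beta -> 0 <= delta -> delta <= 1 / 2 ->
  {in A, forall i : 'I_n, exists p : int, `|theta + i%:R * beta - p%:~R| <= delta} ->
  #|A|%:R <= (n%:R * beta + 2) * (2 * delta / beta + 1).
Proof.
move=> b0 d0 d12 Ap.
have /choice[f fP] : forall i : 'I_n, exists p : int,
    i \in A -> `|theta + i%:R * beta - p%:~R| <= delta.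
  move=> i; have [/Ap[p hp]|_] := boolP (i \in A); first by exists p.
  by exists 0.
have w0 : 0 <= 2 * delta / beta by rewrite divr_ge0 ?mulr_ge0 ?(ltW b0).
have fib v : #|[set y in A | f y == v]|%:R <= 2 * delta / beta + 1.
  apply: (@card_le_window _ _ (fun i : 'I_n => (i : nat)%:Z)) => //.
    by move=> i j _ _ [] /val_inj.
  move=> i j; rewrite !inE => /andP[iA /eqP fi] /andP[jA /eqP fj].
  have := fP _ iA; have := fP _ jA; rewrite fi fj !ler_norml => /andP[? ?] /andP[? ?].
  rewrite ler_pdivlMr // intrB /= mulrBl -!pmulrn; lra.
have w1 : 0 <= n%:R * beta + 1 by rewrite addr_ge0 // mulr_ge0 ?(ltW b0).
have -> : n%:R * beta + 2 = n%:R * beta + 1 + 1 :> R by lra.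
apply: (@le_trans _ _ ((n%:R * beta + 1 + 1) * (Num.truncn (2 * delta / beta + 1))%:R)).
  apply: (@card_le_fibers _ _ f) => //; last first.
    by move=> v; rewrite truncn_ge_nat ?fib // addr_ge0.
  move=> i j iA jA; have := fP _ iA; have := fP _ jA.
  rewrite !ler_norml => /andP[? ?] /andP[? ?]; rewrite intrB.
  have : j%:R * beta <= n%:R * beta by rewrite ler_pM2r // ler_nat ltnW.
  have : 0 <= i%:R * beta by rewrite mulr_ge0 ?(ltW b0).
  lra.
by apply: ler_wpM2l; [exact: addr_ge0|rewrite truncn_le addr_ge0].
Qed.

Lemma card_box (s n : nat) (A : {set {ffun 'I_s -> 'I_n}}) (B : 'I_s -> {set 'I_n})
    (w : R) :
  0 <= w -> (forall j, #|B j|%:R <= w) ->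
  {in A, forall (a : {ffun 'I_s -> 'I_n}) j, a j \in B j} -> #|A|%:R <= w ^+ s.
Proof.
move=> w0 Bw AB.
have AF : (#|A| <= #|(family (fun j => mem (B j)))|)%N.
  apply: subset_leq_card; apply/fintype.subsetP => a aA.
  by apply/familyP => j; exact: AB.
have -> : w ^+ s = \prod_(j < s) w by rewrite prodr_const card_ord.
apply: (@le_trans _ _ (\prod_(j < s) #|B j|%:R)); last first.
  by apply: ler_prod => j _; rewrite ler0n /=.
rewrite -natr_prod ler_nat; apply: leq_trans AF _.
by rewrite card_family foldrE big_map big_enum.
Qed.
End Counting.

(** Dirichlet's theorem on simultaneous approximation: among the [m ^ s + 1]
    vectors of fractional parts of [q * x], [0 <= q <= m ^ s], two fall in the
    same box of side [1 / m], and the difference of their indices is the required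
    [q]. *)
Lemma dirichlet (R : realType) (s m : nat) (x : 'I_s -> R) : (0 < m)%N ->
  exists q : nat, [/\ (0 < q)%N, (q <= m ^ s)%N &
    forall j, exists p : int, `|q%:R * x j - p%:~R| <= m%:R^-1].
Proof.
case: m => // m _.
pose fr (q : nat) j := q%:R * x j - (Num.floor (q%:R * x j))%:~R.
have fr0 q j : 0 <= fr q j by rewrite subr_ge0 floor_le.
have fr1 q j : fr q j < 1.
  by rewrite ltrBlDl; have := floorD1_gt (q%:R * x j); rewrite intrD.
pose g (q : 'I_(m.+1 ^ s).+1) : {ffun 'I_s -> 'I_m.+1} :=
  [ffun j => inord (Num.truncn (m.+1%:R * fr q j))].
have /injectivePn[a [b ab gab]] : ~~ injectiveb g.
  apply/injectiveP => /leq_card; rewrite card_ord card_ffun !card_ord ltnn //.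
wlog ab' : a b ab gab / (a < b)%N.
  move=> h; have : (a != b :> nat) by [].
  by rewrite neq_ltn => /orP[]; [exact: h|apply: h => //; rewrite eq_sym].
exists (b - a)%N; split; first by rewrite subn_gt0.
  by rewrite -ltnS; apply: leq_ltn_trans (leq_subr _ _) (ltn_ord b).
move=> j; exists (Num.floor (b%:R * x j) - Num.floor (a%:R * x j)).
rewrite natrB; last exact: ltnW.
rewrite intrB mulrBl.
have -> : b%:R * x j - a%:R * x j -
  ((Num.floor (b%:R * x j))%:~R - (Num.floor (a%:R * x j))%:~R) = fr b j - fr a j.
  by rewrite /fr; ring.
have m0 : 0 < m.+1%:R :> R by [].
have M0 q : 0 <= m.+1%:R * fr q j by rewrite mulr_ge0.
have tr (q : nat) : (Num.truncn (m.+1%:R * fr q j) < m.+1)%N.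
  by rewrite truncn_lt_nat // -[ltRHS]mulr1 ltr_pM2l.
have /(congr1 (@nat_of_ord _)) : g a j = g b j by rewrite gab.
rewrite !ffunE !inordK // => tE.
have := truncn_itv (M0 a); have := truncn_itv (M0 b); rewrite tE.
move: (Num.truncn _) => T; rewrite -(natr1 T) => /andP[? ?] /andP[? ?].
have normE : `|fr b j - fr a j| * m.+1%:R = `|m.+1%:R * fr b j - m.+1%:R * fr a j|.
  by rewrite -mulrBr normrM mulrC (gtr0_norm m0).
rewrite -div1r ler_pdivlMr // normE ler_norml.
by apply/andP; split; lra.
Qed.

(** * Well spread rational points *)

Lemma leq_card_bigcup (T I : finType) (A : I -> {set T}) :
  (#|\bigcup_i A i| <= \sum_i #|A i|)%N.
Proof.
apply: (big_ind2 (fun (B : {set T}) n => #|B| <= n)%N); first by rewrite cards0.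
  by move=> B n C m hB hC; apply: leq_trans (leq_add hB hC); exact: leq_card_setU.
by [].
Qed.

Lemma sum_ltn_le (K q : nat) : (\sum_(i < K) (i.+1 < q) <= q)%N.
Proof.
have : (\sum_(i < K) (i.+1 < q) <= minn K q)%N.
  elim: K => [|K IH]; first by rewrite big_ord0.
  by rewrite big_ord_recr /=; move: IH; case: ltnP => /= ? ?; lia.
by move/leq_trans; apply; exact: geq_minr.
Qed.

(** A ball of radius [r] contains about [r ^ s * m ^ (s * (s + 1))] rational points
    with denominators of the order of [m ^ s], and they are spread out as evenly
    as the points of a grid of step [rho = m ^ - (s + 1)].

    Dirichlet's theorem at the points of a grid of step [4 * kappa * rho] attaches
    to each of them a rational point. If its denominator is at least
    [m ^ s / kappa], this rational point is within [kappa * rho], so distinct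
    grid points get well separated rational points, whence the last
    conclusion. The grid points attached to a smaller denominator [q] are those for
    which all coordinates of [q * x] are within [1 / m] of integers; this is a
    product condition, so [card_near_int] bounds their number coordinate by
    coordinate, and the choice of [kappa] makes the total at most half of the
    grid. *)
Lemma separated_rationals (R : realType) (s : nat) : (0 < s)%N ->
  exists2 kappa : nat, (0 < kappa)%N & exists2 c1 : R, 0 < c1 &
  forall (c : 'rV[R]_s) (r : R), 0 < r ->
  exists m0 : nat, forall m : nat, (m0 <= m)%N ->
  exists (T : finType) (G : {set T}) (y : T -> 'rV[R]_s) (q : T -> nat),
  let rho := (m%:R ^+ s.+1)^-1 in
  [/\ c1 * (r / rho) ^+ s <= #|G|%:R,
      {in G, forall a, [/\ (0 < q a)%N, (q a <= m ^ s)%N, (m ^ s <= kappa * q a)%N &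
         forall j, exists p : int, y a 0 j = p%:~R / (q a)%:R]},
      {in G, forall a j, `|y a 0 j - c 0 j| <= r / 2} &
      forall (H : {set T}) (w : R), 0 <= w -> H \subset G ->
        {in H &, forall a b j, `|y a 0 j - y b 0 j| <= w} ->
        #|H|%:R <= (w / rho + 2) ^+ s].
Proof.
(* The denominators [q1 <= q <= m ^ s / kappa] spoil at most [12 ^ s / kappa], that
   is a quarter, of the grid. *)
move=> s0; pose kappa := (4 * 12 ^ s)%N.
have k0 : (0 < kappa)%N by rewrite muln_gt0 expn_gt0.
have k0' : 0 < kappa%:R :> R by rewrite ltr0n.
exists kappa => //; exists (1 / 2 * (1 / (32 * kappa%:R)) ^+ s).
  by rewrite mulr_gt0 // exprn_gt0 // divr_gt0 // mulr_gt0.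
move=> c r r0.
pose q1 := (Num.truncn (16 / r)).+1.
pose E : R := (6 + 96 / r) ^+ s.
have E0 : 0 <= E by rewrite exprn_ge0 // addr_ge0 // divr_ge0 // ltW.
pose m0 := maxn 2 (maxn (Num.truncn (16 * kappa%:R / r)).+1 (Num.truncn (4 * q1%:R * E)).+1).
exists m0 => m; rewrite !geq_max => /and3P[m2 mr mE].
have mr' : 16 * kappa%:R <= r * m%:R.
  rewrite [leRHS]mulrC -ler_pdivrMr //; apply/ltW.
  by apply: lt_le_trans (truncnS_gt _) _; rewrite ler_nat.
have mE' : 4 * q1%:R * E <= m%:R.
  by apply/ltW; apply: lt_le_trans (truncnS_gt _) _; rewrite ler_nat.
have m0' : 0 < m%:R :> R by rewrite ltr0n (leq_trans _ m2).
pose rho : R := (m%:R ^+ s.+1)^-1.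
have rho0 : 0 < rho by rewrite invr_gt0 exprn_gt0.
have rhoE : m%:R ^+ s * (m%:R * rho) = 1.
  by rewrite mulrA -exprSr /rho mulfV // expf_neq0 // gt_eqF.
have m1 : 1 <= m%:R :> R by rewrite ler1n (leq_trans _ m2).
have mrho : m%:R * rho <= 1.
  by rewrite -[leRHS]rhoE ler_peMl ?mulr_ge0 ?(ltW m0') ?(ltW rho0) // exprn_ege1.
have krho : 16 * (kappa%:R * rho) <= r.
  rewrite mulrA.
  apply: (@le_trans _ _ (r * m%:R * rho)); first by rewrite ler_pM2r.
  by rewrite -mulrA ger_pMr.
pose h : R := 4 * (kappa%:R * rho).
have kr0 : 0 < kappa%:R * rho by rewrite mulr_gt0.
have h0 : 0 < h by rewrite mulr_gt0.
pose n := Num.truncn (r / (4 * h)).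
have nle : n%:R * h <= r / 4.
  have : n%:R <= r / (4 * h) by rewrite /n truncn_le divr_ge0 // ltW // mulr_gt0.
  rewrite ler_pdivlMr ?mulr_gt0 //; lra.
have nge : r <= n%:R * (8 * h).
  have := truncnS_gt (r / (4 * h)); rewrite -/n -natr1 ltr_pdivrMr ?mulr_gt0 // => H1.
  have n1 : 1 <= n%:R :> R.
    by rewrite ler1n truncn_gt0 ler_pdivlMr ?mulr_gt0 // mul1r /h; lra.
  have : 1 * h <= n%:R * h by rewrite ler_pM2r.
  lra.
pose x (a : {ffun 'I_s -> 'I_n}) j : R := c 0 j + (a j)%:R * h.
have mn0 : (0 < m)%N by rewrite (leq_trans _ m2).
have /choice[q qP] : forall a, exists q : nat, [/\ (0 < q)%N, (q <= m ^ s)%N &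
    forall j, exists p : int, `|q%:R * x a j - p%:~R| <= m%:R^-1].
  by move=> a; exact: dirichlet.
have /choice[p pP] : forall a, exists p : 'I_s -> int,
    forall j, `|(q a)%:R * x a j - (p j)%:~R| <= m%:R^-1.
  by move=> a; have [_ _ /choice[f fP]] := qP a; exists f.
pose y a : 'rV[R]_s := \row_j ((p a j)%:~R / (q a)%:R).
pose G := [set a | (m ^ s <= kappa * q a)%N].
have q0 a : 0 < (q a)%:R :> R by have [? _ _] := qP a; rewrite ltr0n.
have yx a j : a \in G -> `|y a 0 j - x a j| <= kappa%:R * rho.
  rewrite inE => aG; rewrite mxE.
  have -> : (p a j)%:~R / (q a)%:R - x a j = - ((q a)%:R * x a j - (p a j)%:~R) / (q a)%:R.
    by field; rewrite gt_eqF.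
  rewrite normrM normrN normfV (gtr0_norm (q0 a)) ler_pdivrMr //.
  apply: (le_trans (pP a j)).
  have -> : m%:R^-1 = m%:R ^+ s * rho.
    apply: (@mulIf _ m%:R); first by rewrite gt_eqF.
    by rewrite mulVf ?gt_eqF // -mulrA [rho * _]mulrC rhoE.
  rewrite mulrAC ler_pM2r // -natrX -natrM ler_nat //.
exists _, G, y, q; rewrite -/rho; split=> /=.
-
  (* At most half of the grid points have a denominator below [m ^ s / kappa].
     The bound [W] is of the order of [n / m] except for the boundedly many [q]
     below [q1], whose contribution is absorbed by taking [m] large. *)
  have mV : 1 <= m%:R * m%:R^-1 :> R by rewrite mulfV // gt_eqF.
  pose B (i : 'I_((m ^ s) %/ kappa)) j :=
    [set k : 'I_n | `[< exists p : int, `|i.+1%:R * c 0 j + k%:R * (i.+1%:R * h) - p%:~R| <= m%:R^-1 >]].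
  pose W (i : nat) : R := n%:R / m%:R * (6 + 96 / (i.+1%:R * r)).
  have BW i j : #|B i j|%:R <= W i.
    have b0 : 0 < i.+1%:R * h by rewrite mulr_gt0.
    have mV0 : 0 <= m%:R^-1 :> R by rewrite invr_ge0 ltW.
    apply: (le_trans (@card_near_int R (i.+1%:R * c 0 j) _ _ n (B i j) b0 mV0 _ _)).
    + by rewrite div1r lef_pV2 ?posrE // ler_nat.
    + by move=> k; rewrite inE => /asboolP.
    have b4 : m%:R * (i.+1%:R * h) <= 4.
      have : (i.+1 * kappa <= m ^ s)%N by rewrite -leq_divRL // ltn_ord.
      rewrite -(ler_nat R) natrM natrX => H.
      have : i.+1%:R * kappa%:R * (m%:R * rho) <= 1.
        by rewrite -[leRHS]rhoE ler_pM2r // mulr_gt0.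
      by rewrite /h; clear; lra.
    set b := i.+1%:R * h in b0 b4 *.
    have mb0 : 0 < m%:R * b by rewrite mulr_gt0.
    apply: (@le_trans _ _ ((n%:R * b + 2) * (6 / (m%:R * b)))).
      apply: ler_wpM2l; first by rewrite addr_ge0 // mulr_ge0 // ltW.
      have -> : 2 * m%:R^-1 / b = 2 / (m%:R * b).
        by field; rewrite !gt_eqF.
      have : 1 <= 4 / (m%:R * b) by rewrite ler_pdivlMr // mul1r.
      have -> : 6 / (m%:R * b) = 2 / (m%:R * b) + 4 / (m%:R * b) by field; rewrite !gt_eqF.
      by clear; lra.
    have -> : (n%:R * b + 2) * (6 / (m%:R * b)) = 6 * (n%:R / m%:R) + 12 / (m%:R * b).
      by field; rewrite !gt_eqF.
    have -> : W i = 6 * (n%:R / m%:R) + 12 / (m%:R * b) * (n%:R * (8 * h) / r).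
      by rewrite /W /b; field; rewrite !gt_eqF.
    by rewrite lerD2l ler_peMr ?divr_ge0 ?(ltW mb0) // ler_pdivlMr // mul1r.
  have nm0 : 0 <= n%:R / m%:R :> R by rewrite divr_ge0.
  have W0 i : 0 <= W i.
    by rewrite mulr_ge0 // addr_ge0 // divr_ge0 // mulr_ge0 // ltW.
  have Ws i : W i ^+ s <= (n%:R / m%:R) ^+ s * (12 ^+ s + (i.+1 < q1)%:R * E).
    rewrite /W exprMn; apply: ler_wpM2l; first exact: exprn_ge0.
    have i0 : 0 < i.+1%:R * r by rewrite mulr_gt0.
    have b0 : 0 <= 6 + 96 / (i.+1%:R * r) by rewrite addr_ge0 // divr_ge0 // ltW.
    case: ltnP => iq.
      rewrite mul1r; apply: (@le_trans _ _ E); last by rewrite lerDr exprn_ge0.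
      rewrite /E lerXn2r ?nnegrE // ?(le_trans b0) //; rewrite lerD2l;
        by rewrite ler_pM2l // lef_pV2 ?posrE // ler_peMl ?ler1n // ltW.
    rewrite mul0r addr0 lerXn2r ?nnegrE //.
    have : 96 / (i.+1%:R * r) <= 6.
      rewrite ler_pdivrMr //; have : 16 / r <= i.+1%:R.
        by apply/ltW; apply: lt_le_trans (truncnS_gt _) _; rewrite ler_nat.
      by rewrite ler_pdivrMr //; clear; lra.
    have -> : 12 = 6 + 6 :> R by ring.
    by rewrite lerD2l.
  have bad : #|~: G|%:R <= n%:R ^+ s / 2 :> R.
    pose Bad i := [set a : {ffun 'I_s -> 'I_n} | [forall j, a j \in B i j]].
    have sub : ~: G \subset \bigcup_i Bad i.
      apply/fintype.subsetP => a; rewrite !inE -ltnNge => qa.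
      have [qa0 _ _] := qP a.
      have iq : ((q a).-1 < (m ^ s) %/ kappa)%N.
        by rewrite prednK // leq_divRL // mulnC ltnW.
      apply/finset.bigcupP; exists (Ordinal iq) => //; rewrite inE; apply/forallP => j.
      rewrite inE; apply/asboolP; exists (p a j); rewrite /= prednK //.
      by have := pP a j; rewrite /x mulrDr mulrCA.
    have := leq_trans (subset_leq_card sub) (leq_card_bigcup _).
    rewrite -(ler_nat R) natr_sum => /le_trans; apply.
    apply: (@le_trans _ _ (\sum_(i < (m ^ s) %/ kappa)
        (n%:R / m%:R) ^+ s * (12 ^+ s + (i.+1 < q1)%:R * E))).
      apply: ler_sum => i _; apply: le_trans (Ws i).
      apply: (@card_box R s n (Bad i) (B i)) => // a.
      by rewrite inE => /forallP.
    rewrite -mulr_sumr big_split /= sumr_const card_ord -mulr_suml -natr_sum.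
    rewrite exprMn exprVn -mulrA ler_pM2l; last first.
      by rewrite exprn_gt0 // ltr0n lt0n; apply/negP => /eqP n0; move: nge; rewrite n0; clear - r0; lra.
    have ms0 : 0 < m%:R ^+ s :> R by rewrite exprn_gt0.
    rewrite mulrC ler_pdivrMr //.
    have H1 : 12 ^+ s *+ (m ^ s %/ kappa) <= m%:R ^+ s / 4 :> R.
      rewrite -mulr_natr.
      have := leq_trunc_div (m ^ s) kappa; rewrite -(ler_nat R) natrM !natrX.
      by rewrite /kappa natrM natrX; clear; lra.
    have H2 : (\sum_(i < m ^ s %/ kappa) (i.+1 < q1))%:R * E <= q1%:R * E.
      by rewrite ler_wpM2r // ler_nat sum_ltn_le.
    have H3 : m%:R <= m%:R ^+ s :> R by rewrite ler_eXnr.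
    by clear - H1 H2 H3 mE'; lra.
  have cG : #|G|%:R + #|~: G|%:R = n%:R ^+ s :> R.
    by rewrite -natrD cardsC card_ffun !card_ord natrX.
  have : (1 / (32 * kappa%:R)) ^+ s * (r / rho) ^+ s <= n%:R ^+ s.
    rewrite -exprMn lerXn2r ?nnegrE //.
      by rewrite !mulr_ge0 ?invr_ge0 ?mulr_ge0 ?(ltW k0') ?(ltW r0) ?(ltW rho0).
    have -> : 1 / (32 * kappa%:R) * (r / rho) = r / (8 * h).
      by rewrite /h; field; rewrite !gt_eqF.
    by rewrite ler_pdivrMr // mulr_gt0.
  by clear - bad cG; lra.
- move=> a aG; have [? ? _] := qP a; split => //; first by rewrite inE in aG.
  by move=> j; exists (p a j); rewrite mxE.
- move=> a aG j.
  have ->: y a 0 j - c 0 j = y a 0 j - x a j + (a j)%:R * h by rewrite /x; ring.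
  apply: le_trans (ler_normD _ _) _.
  have := yx a j aG.
  have : `|(a j)%:R * h| <= n%:R * h.
    rewrite ger0_norm; last by rewrite mulr_ge0 // ltW.
    by rewrite ler_pM2r // ler_nat ltnW.
  by clear - nle krho r0; lra.
- move=> H w w0 /fintype.subsetP HG Hw.
  have wr : 0 <= w / rho by rewrite divr_ge0 // ltW.
  apply: (@card_box R s n H (fun j => [set a j | a : {ffun 'I_s -> 'I_n} in H])).
  + by rewrite addr_ge0.
  + move=> j; have -> : w / rho + 2 = w / rho + 1 + 1 by ring.
    apply: (@card_le_window R _ _ (fun i : 'I_n => (i : nat)%:Z)).
    * by rewrite addr_ge0.
    * by move=> ? ? _ _ [] /val_inj.
    move=> _ _ /imsetP[a aH ->] /imsetP[b bH ->].
    have -> : w / rho + 1 = (w + rho) / rho by field; rewrite gt_eqF.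
    have := yx a j (HG _ aH); have := yx b j (HG _ bH); have := Hw a b aH bH j.
    rewrite !ler_norml /x => /andP[? ?] /andP[? ?] /andP[? ?].
    have : (b j)%:R * h - (a j)%:R * h <= w + 2 * (kappa%:R * rho) by lra.
    rewrite -mulrBl -ler_pdivlMr // intrB -!pmulrn => /le_trans; apply.
    rewrite ler_pdivrMr // /h.
    have k1 : 1 <= kappa%:R :> R by rewrite ler1n.
    have -> : (w + rho) / rho * (4 * (kappa%:R * rho)) = (w + rho) * (4 * kappa%:R).
      by field; rewrite gt_eqF.
    have : w * 1 <= w * kappa%:R by rewrite ler_wpM2l.
    by clear - kr0 w0; lra.
  by move=> a aH j; apply/imsetP; exists a.
Qed.

(** * Nested balls avoiding a family of sets *)

Section PowR.
Context {R : realType}.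
Implicit Types x y a b : R.

Lemma gt0_powRD x a b : 0 < x -> x `^ (a + b) = x `^ a * x `^ b.
Proof. by move=> x0; rewrite powRD //; apply/implyP => _; rewrite gt_eqF. Qed.

Lemma ler_powR2r a x y : 0 <= a -> 0 <= x -> x <= y -> x `^ a <= y `^ a.
Proof. by move=> a0 x0 xy; apply: ge0_ler_powR; rewrite ?nnegrE // (le_trans x0). Qed.

Lemma ler_powRN2r a x y : 0 <= a -> 0 < x -> x <= y -> y `^ (- a) <= x `^ (- a).
Proof.
move=> a0 x0 xy; have y0 := lt_le_trans x0 xy.
by rewrite !powRN lef_pV2 ?posrE ?powR_gt0 // ler_powR2r // ltW.
Qed.

Lemma natr_powR_large (sigma X : R) : 0 < sigma ->
  exists m0 : nat, forall m : nat, (m0 <= m)%N -> X <= m%:R `^ sigma.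
Proof.
move=> s0; exists (Num.truncn (Num.max 0 X `^ sigma^-1)).+1 => m mm.
have M0 : 0 <= Num.max 0 X by rewrite le_max lexx.
apply: (@le_trans _ _ (Num.max 0 X)); first by rewrite le_max lexx orbT.
have {1}-> : Num.max 0 X = (Num.max 0 X `^ sigma^-1) `^ sigma.
  by rewrite -powRrM mulVf ?gt_eqF // powRr1.
apply: ler_powR2r; rewrite ?powR_ge0 ?(ltW s0) //.
by apply/ltW/(lt_le_trans (truncnS_gt _)); rewrite ler_nat.
Qed.

End PowR.

Section Jarnik.
Context {R : realType} {s : nat} (s0 : (0 < s)%N) (tau t : R).
Context (tau1 : 1 < tau) (t0 : 0 < t) (tau_t : t * (tau + 1) < s%:R + 1).

Definition cball (c : 'rV[R]_s) (r : R) : set 'rV[R]_s :=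
  fun x => forall j, `|x 0 j - c 0 j| <= r.

Definition meets (U : set 'rV[R]_s) c r : Prop := exists2 x, U x & cball c r x.

(** The sets [U i], of weight [a i], that meet the ball have together a small
    weight compared with the natural content [r `^ t] of the ball. This is the
    invariant that the nested balls below preserve. *)
Definition light (eta : R) (U : nat -> set 'rV[R]_s) (a : nat -> R) c r : Prop :=
  forall n, \sum_(i < n | `[< meets (U i) c r >]) a i <= eta * r `^ t.

Let s1 : 1 <= s%:R :> R. Proof. by rewrite ler1n. Qed.

Let t_lt_s : t < s%:R.
Proof.
have : t * 2 < t * (tau + 1) by rewrite ltr_pM2l //; move: tau1; lra.
by move: tau_t s1; lra.
Qed.

Lemma expr_add3_le (x : R) : 0 <= x -> (x + 3) ^+ s <= 6 ^+ s * (1 + x ^+ s).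
Proof.
move=> x0; rewrite mulrDr mulr1; have [x3|x3] := leP x 3.
  apply: (@le_trans _ _ (6 ^+ s)); first by rewrite lerXn2r ?nnegrE //; lra.
  by rewrite lerDl mulr_ge0 // exprn_ge0.
apply: (@le_trans _ _ (6 ^+ s * x ^+ s)); last by rewrite lerDr exprn_ge0.
by rewrite -exprMn lerXn2r ?nnegrE //; lra.
Qed.

(** Suppose that none of the balls of radius [r' = Q `^ - (tau + 1)], [Q = m ^ s],
    around the points of [separated_rationals] is light. Then every one of
    them meets sets of total weight more than [theta = eta * r' `^ t], where the
    weight of a set may be truncated at [theta]. A set of diameter [w] meets at
    most [6 ^ s * (1 + (w / rho) ^ s)] of these balls, so summing the truncated
    weights over all balls bounds their number by a multiple of
    [r `^ t / r' `^ t + eta * (r / rho) ^ s]. The first term is negligible with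
    respect to [(r / rho) ^ s] because [t * (tau + 1) < s + 1], and the second one
    because [eta] is small: this contradicts the number of points. *)
Lemma light_child : exists2 eta : R, 0 < eta &
  forall (U : nat -> set 'rV[R]_s) (a : nat -> R),
  (forall i, 0 < a i) ->
  (forall i x y, U i x -> U i y -> forall j, `|x 0 j - y 0 j| `^ t <= a i) ->
  forall c r, 0 < r -> light eta U a c r ->
  forall N : nat, exists c' r', [/\ 0 < r', r' <= r / 2, light eta U a c' r',
    (forall j, `|c' 0 j - c 0 j| + r' <= r) &
    exists q : nat, [/\ (0 < q)%N, (N <= q)%N, r' <= q%:R `^ (- (tau + 1)) &
      forall j, exists p : int, c' 0 j = p%:~R / q%:R]].
Proof.
have [kappa k0 [c1 c10 sepP]] := @separated_rationals R s s0.
pose eta : R := Num.min 1 (c1 / (4 * 6 ^+ s)).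
have six0 : 0 < 6 ^+ s :> R by rewrite exprn_gt0.
have eta0 : 0 < eta by rewrite lt_min ltr01 /= divr_gt0 // mulr_gt0.
have eta1 : eta <= 1 by rewrite ge_min lexx.
have etac : 6 ^+ s * eta <= c1 / 4.
  have : eta <= c1 / (4 * 6 ^+ s) by rewrite ge_min lexx orbT.
  by rewrite ler_pdivlMr ?mulr_gt0 //; lra.
exists eta => // U a a0 Ua c r r0 lB N.
have [m1 sepm] := sepP c r r0.
have sig1 : 0 < s%:R * (tau + 1) - (s%:R + 1).
  have : s%:R * 1 < s%:R * tau by rewrite ltr_pM2l // (lt_le_trans ltr01).
  by move: s1; lra.
have sig2 : 0 < s%:R * (s%:R + 1 - t * (tau + 1)).
  by rewrite mulr_gt0 ?subr_gt0 // (lt_le_trans ltr01).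
have [m2 Hm2] := natr_powR_large 2 sig1.
have [m3 Hm3] := natr_powR_large (4 * 6 ^+ s * r `^ t / (c1 * r ^+ s)) sig2.
have [m4 Hm4] := natr_powR_large r^-1 (@ltr01 R).
(* Apart from the counting ([m1]), a large [m] makes [2 * r' <= rho] ([m2]), makes
   [r `^ t / r' `^ t] negligible ([m3]), makes [rho <= r] ([m4]), and makes the
   denominators at least [N]. *)
pose m := maxn 1 (maxn m1 (maxn m2 (maxn m3 (maxn m4 (kappa * N))))).
have /and5P[mm0 mm1 mm2 mm3 /andP[mm4 mmN]] :
  [&& (1 <= m)%N, (m1 <= m)%N, (m2 <= m)%N, (m3 <= m)%N & (m4 <= m)%N && (kappa * N <= m)%N].
  by rewrite /m !leq_max !leqnn /= !orbT.
move: (m) mm0 mm1 mm2 mm3 mm4 mmN => {}m mm0 mm1 mm2 mm3 mm4 mmN.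
have {sepm} := sepm _ mm1; set rho : R := (m%:R ^+ s.+1)^-1.
move=> [T [G [y [q [Gcard Gq Gc Gsep]]]]].
have {Hm2} Hm2 := Hm2 _ mm2; have {Hm3} Hm3 := Hm3 _ mm3; have {Hm4} Hm4 := Hm4 _ mm4.
have m0 : 0 < m%:R :> R by rewrite ltr0n.
have mge1 : 1 <= m%:R :> R by rewrite ler1n.
have rho0 : 0 < rho by rewrite invr_gt0 exprn_gt0.
have rhoE : rho = m%:R `^ (- (s%:R + 1)).
  by rewrite powRN natr1 powR_mulrn // ltW.
pose r' : R := m%:R `^ (- (s%:R * (tau + 1))).
have r'0 : 0 < r' by rewrite powR_gt0.
have r'rho : 2 * r' <= rho.
  have -> : rho = m%:R `^ (s%:R * (tau + 1) - (s%:R + 1)) * r'.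
    by rewrite rhoE /r' -gt0_powRD //; congr (_ `^ _); lra.
  by rewrite ler_pM2r.
have rhor : rho <= r.
  rewrite -[leRHS]invrK lef_pV2 ?posrE ?invr_gt0 ?exprn_gt0 //.
  apply: (le_trans Hm4); rewrite powRr1 ?ler_eXnr //; exact: ltW.
pose theta := eta * r' `^ t.
have th0 : 0 < theta by rewrite mulr_gt0 // powR_gt0.
pose hit i k := `[< meets (U i) (y k) r' >].
have cB k x : k \in G -> cball (y k) r' x -> cball c r x.
  move=> kG xk j; have := xk j; have := Gc _ kG j => H1 H2.
  have -> : x 0 j - c 0 j = (x 0 j - y k 0 j) + (y k 0 j - c 0 j) by ring.
  by apply: (le_trans (ler_normD _ _)); clear - s0 t0 tau1 tau_t s1 t_lt_s H1 H2 r'rho rhor; lra.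
have hB i k : k \in G -> hit i k -> `[< meets (U i) c r >].
  by move=> kG /asboolP[x Ux xk]; apply/asboolP; exists x => //; exact: cB xk.
have [[k kG lk]|nk] := pselect (exists2 k, k \in G & light eta U a (y k) r').
  have [qk0 qkm mqk yq] := Gq _ kG.
  exists (y k), r'; split => //; first by clear - s0 t0 tau1 tau_t s1 t_lt_s r'rho rhor; lra.
    by move=> j; have := Gc _ kG j; clear - s0 t0 tau1 tau_t s1 t_lt_s r'rho rhor; lra.
  exists (q k); split => //.
    have : (kappa * N <= kappa * q k)%N.
      by apply: leq_trans mmN (leq_trans _ mqk); rewrite -[X in (X <= _)%N]expn1 leq_pexp2l.
    by rewrite leq_pmul2l.
  rewrite /r' -mulrN powRrM powR_mulrn ?(ltW m0) // -natrX.
  by apply: ler_powRN2r; rewrite ?ler_nat ?ltr0n //; move: tau1; clear - s0 t0 tau_t s1 t_lt_s; lra.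
exfalso.
have {nk} /choice[n nP] : forall k, exists n, k \in G ->
    theta < \sum_(i < n | hit i k) a i.
  move=> k; have [kG|_] := boolP (k \in G); last by exists 0%N.
  apply: contrapT => /forallNP h; apply: nk; exists k => // n.
  by have := h n; rewrite leNgt => hn; apply/negP => hn'; apply: hn.
(* Finitely many balls, so one common truncation of the family suffices. *)
pose M := (\max_k n k)%N.
have hM k : k \in G -> theta < \sum_(i < M | hit i k) a i.
  move=> kG; apply: (lt_le_trans (nP k kG)).
  have nM : (n k <= M)%N by exact: leq_bigmax.
  rewrite (big_ord_widen_cond _ (fun i => hit i k) a nM).
  rewrite [leRHS](bigID (fun i : 'I_M => (i < n k)%N)) /= lerDl.
  by apply: sumr_ge0 => i _; exact: ltW.
pose b i := Num.min 1 (a i / theta).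
have b0 i : 0 <= b i by rewrite le_min ler01 /= divr_ge0 // ltW.
have hb k : k \in G -> 1 <= \sum_(i < M | hit i k) b i.
  move=> kG; have [/existsP[i /andP[ik ai]]|/existsPn H] :=
      boolP [exists i : 'I_M, hit i k && (theta <= a i)].
    rewrite (bigD1 i) //= -[leLHS]addr0 lerD ?sumr_ge0 //.
    by rewrite le_min lexx ler_pdivlMr // mul1r.
  have -> : \sum_(i < M | hit i k) b i = (\sum_(i < M | hit i k) a i) / theta.
    rewrite mulr_suml; apply: eq_bigr => i ik; apply/min_r.
    have := H i; rewrite ik /= -ltNge => /ltW; rewrite ler_pdivrMr // mul1r //.
  by rewrite ler_pdivlMr // mul1r ltW // hM.
have aw i x z j : U i x -> U i z -> `|x 0 j - z 0 j| <= a i `^ t^-1.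
  move=> Ux Uz; have := Ua i x z Ux Uz j => /(ler_powR2r (a := t^-1)).
  rewrite -powRrM mulfV ?gt_eqF // powRr1 //; apply; rewrite ?powR_ge0 //.
  by rewrite invr_ge0 ltW.
pose I (i : 'I_M) := `[< meets (U i) c r >].
have Hi i : I i -> #|[set k in G | hit i k]|%:R * b i <=
    6 ^+ s * (theta^-1 + r `^ (s%:R - t) / rho ^+ s) * a i.
  move=> Ii; have w0 : 0 <= a i `^ t^-1 by exact: powR_ge0.
  have ai : a i <= r `^ t.
    have := lB M; rewrite (bigD1 i) //= => H.
    have : 0 <= \sum_(j < M | `[< meets (U j) c r >] && (j != i)) a j.
      by apply: sumr_ge0 => j _; exact: ltW.
    have : eta * r `^ t <= 1 * r `^ t by rewrite ler_wpM2r // powR_ge0.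
    by clear - s0 t0 tau1 tau_t s1 t_lt_s H; lra.
  have Hc : #|[set k in G | hit i k]|%:R <= 6 ^+ s * (1 + (a i `^ t^-1 / rho) ^+ s).
    apply: (@le_trans _ _ (((a i `^ t^-1 + rho) / rho + 2) ^+ s)).
      apply: Gsep.
      - by rewrite addr_ge0 // ltW.
      - by apply/fintype.subsetP => k; rewrite inE => /andP[].
      move=> k l; rewrite !inE => /andP[_ /asboolP[x Ux xk]] /andP[_ /asboolP[z Uz zl]] j.
      have := aw _ _ _ j Ux Uz; have := xk j; have := zl j.
      rewrite !ler_norml => /andP[z1 z2] /andP[x1 x2] /andP[w1 w2].
      by clear - s0 t0 tau1 tau_t s1 t_lt_s z1 z2 x1 x2 w1 w2 r'rho; apply/andP; split; lra.
    have -> : (a i `^ t^-1 + rho) / rho + 2 = a i `^ t^-1 / rho + 3.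
      by field; rewrite gt_eqF.
    by apply: expr_add3_le; rewrite divr_ge0 // ltW.
  have ws : (a i `^ t^-1) ^+ s <= r `^ (s%:R - t) * a i.
    rewrite -powR_mulrn // -powRrM.
    have -> : t^-1 * s%:R = (s%:R - t) / t + 1 by field; rewrite gt_eqF.
    rewrite gt0_powRD // powRr1 ?(ltW (a0 i)) // ler_pM2r //.
    have -> : r `^ (s%:R - t) = (r `^ t) `^ ((s%:R - t) / t).
      by rewrite -powRrM mulrCA mulfV ?gt_eqF // mulr1.
    by apply: ler_powR2r => //; [rewrite divr_ge0 ?subr_ge0 // ltW|exact: ltW].
  apply: (le_trans (ler_wpM2r (b0 i) Hc)); rewrite -!mulrA ler_pM2l // !mulrDl mul1r.
  apply: lerD; first by rewrite mulrC ge_min lexx orbT.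
  apply: (@le_trans _ _ ((a i `^ t^-1 / rho) ^+ s)).
    apply: ler_piMr; last by rewrite ge_min lexx.
    by rewrite exprn_ge0 // divr_ge0 // ltW.
  rewrite exprMn exprVn mulrAC ler_pM2r // invr_gt0 exprn_gt0 //.
have : #|G|%:R <= 6 ^+ s * (theta^-1 + r `^ (s%:R - t) / rho ^+ s) * (eta * r `^ t).
  apply: (@le_trans _ _ (\sum_(k in G) \sum_(i < M | hit i k) b i)).
    by rewrite -sum1_card natr_sum; apply: ler_sum => k kG; exact: hb.
  apply: (@le_trans _ _ (\sum_(i < M | I i) #|[set k in G | hit i k]|%:R * b i)).
    rewrite (exchange_big_dep I) /=; last by move=> k i kG; exact: hB kG.
    apply: ler_sum => i _; rewrite mulr_natl sumr_const.
    suff -> : #|[set k in G | hit i k]| = #|[pred k in G | hit i k]| by [].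
    by apply: eq_card => k; rewrite !inE.
  apply: (@le_trans _ _ (\sum_(i < M | I i) 6 ^+ s * (theta^-1 + r `^ (s%:R - t) / rho ^+ s) * a i)).
    by apply: ler_sum => i; exact: Hi.
  rewrite -mulr_sumr; apply: ler_wpM2l; last exact: lB.
  rewrite mulr_ge0 ?(ltW six0) // addr_ge0 // ?invr_ge0 ?(ltW th0) //.
  by rewrite divr_ge0 ?powR_ge0 // exprn_ge0 // ltW.
apply/negP; rewrite -ltNge; apply: lt_le_trans Gcard.
set X := (r / rho) ^+ s.
have X0 : 0 < X by rewrite exprn_gt0 // divr_gt0.
have -> : 6 ^+ s * (theta^-1 + r `^ (s%:R - t) / rho ^+ s) * (eta * r `^ t) =
    6 ^+ s * (r `^ t / r' `^ t) + (6 ^+ s * eta) * X.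
  rewrite /X /theta exprMn (exprVn rho s).
  have -> : r ^+ s = r `^ (s%:R - t) * r `^ t.
    by rewrite -gt0_powRD // subrK powR_mulrn // ltW.
  have Z0 : r' `^ t != 0 by rewrite gt_eqF // powR_gt0.
  have W0 : rho ^+ s != 0 by rewrite gt_eqF // exprn_gt0.
  have e0 : eta != 0 by rewrite gt_eqF.
  move: (r' `^ t) (rho ^+ s) (6 ^+ s) (r `^ t) (r `^ (s%:R - t)) (eta) Z0 W0 e0.
  by move=> Z W S A B e Z0 W0 e0; field; rewrite Z0 W0 e0.
have H1 : 6 ^+ s * eta * X <= c1 / 4 * X by rewrite ler_pM2r.
have H2 : 6 ^+ s * (r `^ t / r' `^ t) <= c1 / 4 * X.
  have rs0 : 0 < c1 * r ^+ s by rewrite mulr_gt0 // exprn_gt0.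
  move: Hm3; rewrite ler_pdivrMr // => Hm3.
  have Z0 : 0 < r' `^ t by rewrite powR_gt0.
  have -> : X = m%:R `^ (s%:R * (s%:R + 1 - t * (tau + 1))) * r ^+ s / r' `^ t.
    rewrite /X exprMn [RHS]mulrAC [RHS]mulrC; congr (_ * _).
    rewrite (exprVn rho s) rhoE -powR_mulrn ?powR_ge0 // -powRrM -powRN /r' -powRrM -powRN.
    by rewrite -gt0_powRD //; congr (_ `^ _); ring.
  rewrite mulrA mulrA ler_pM2r ?invr_gt0 //; clear - s0 t0 tau1 tau_t s1 t_lt_s Hm3; lra.
have : 0 < c1 * X by rewrite mulr_gt0.
by clear - s0 t0 tau1 tau_t s1 t_lt_s H1 H2; lra.
Qed.

End Jarnik.

(** The combinatorial core of the lower bound in the theorem of Jarnik and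
    Besicovitch. Iterating [light_child] gives nested balls whose common point [x]
    is approximated by each of the rational centres. If [x] were in [U i], then
    [U i] would meet all the balls, and [a i] would be at most [eta] times the
    [t]-th power of their radii, which tends to [0]. *)
Lemma jarnik_avoid (R : realType) (s : nat) (tau t : R) :
  (0 < s)%N -> 1 < tau -> 0 < t -> t * (tau + 1) < s%:R + 1 ->
  exists2 eta : R, 0 < eta &
  forall (U : nat -> set 'rV[R]_s) (a : nat -> R),
  (forall i, 0 < a i) -> (forall n, \sum_(i < n) a i <= eta) ->
  (forall i x y, U i x -> U i y -> forall j, `|x 0 j - y 0 j| `^ t <= a i) ->
  exists x : 'rV[R]_s, (forall N : nat, exists q : nat, [/\ (0 < q)%N, (N <= q)%N &
      forall j, exists p : int, `|q%:R * x 0 j - p%:~R| <= q%:R `^ (- tau)]) /\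
    forall i, ~ U i x.
Proof.
move=> s0 tau1 t0 tt.
have [eta eta0 step] := light_child s0 tau1 t0 tt.
exists eta => // U a a0 aeta Ua.
pose good (z : 'rV[R]_s * R) := 0 < z.2 /\ light t eta U a z.1 z.2.
have /choice[f fP] : forall zN : ('rV[R]_s * R) * nat, exists z' : 'rV[R]_s * R,
    good zN.1 -> [/\ good z', z'.2 <= zN.1.2 / 2,
      (forall j, `|z'.1 0 j - zN.1.1 0 j| + z'.2 <= zN.1.2) &
      exists q : nat, [/\ (0 < q)%N, (zN.2 <= q)%N, z'.2 <= q%:R `^ (- (tau + 1)) &
        forall j, exists p : int, z'.1 0 j = p%:~R / q%:R]].
  move=> [[c r] N] /=; have [[/= r0 lr]|ng] := pselect (good (c, r)); last by exists (c, r).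
  have [c' [r' [r'0 r'r l' sub H]]] := step U a a0 Ua c r r0 lr N.
  by exists (c', r').
pose z := fix z n := if n is n'.+1 then f (z n', n') else (0 : 'rV[R]_s, 1 : R).
have gz n : good (z n).
  elim: n => [|n /(fP (_, n))[]//]; split=> //= n.
  rewrite powR1 mulr1; apply: le_trans (aeta n).
  rewrite [leRHS](bigID (fun i : 'I_n => `[< meets (U i) 0 1 >])) /= lerDl.
  by apply: sumr_ge0 => i _; exact: ltW.
have zS n := fP (_, n) (gz n).
have r0 n : 0 < (z n).2 by case: (gz n).
have rn n : (z n).2 * n.+1%:R <= 1.
  elim: n => [|n IH]; first by rewrite /= mulr1.
  have [_ H _ _] := zS n; have := r0 n; rewrite /= in H.
  have : (z n.+1).2 * n.+2%:R <= (z n).2 / 2 * n.+2%:R by rewrite ler_pM2r.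
  have : (z n).2 * n.+2%:R <= (z n).2 * (2 * n.+1%:R).
    by rewrite ler_pM2l // -natrM ler_nat; lia.
  lra.
pose L j n := (z n).1 0 j - (z n).2; pose M j n := (z n).1 0 j + (z n).2.
have LS j n : L j n <= L j n.+1 /\ M j n.+1 <= M j n.
  have [_ _ /(_ j) /= H _] := zS n.
  have := ler_norm ((z n.+1).1 0 j - (z n).1 0 j).
  have := ler_norm (- ((z n.+1).1 0 j - (z n).1 0 j)); rewrite normrN /L /M /=.
  by split; lra.
have LL j : {homo L j : n k / (n <= k)%N >-> n <= k}.
  by apply: homo_leq => // [? ? ?|n]; [exact: le_trans|have [] := LS j n].
have MM j : {homo M j : n k / (n <= k)%N >-> k <= n}.
  by apply: homo_leq => // [v u w uv vw|n]; [exact: le_trans vw uv|have [] := LS j n].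
have LM j n k : L j n <= M j k.
  apply: (le_trans (LL j _ _ (leq_maxl n k))); apply: le_trans (MM j _ _ (leq_maxr n k)).
  by rewrite /L /M; have := r0 (maxn n k); lra.
pose x : 'rV[R]_s := \row_j sup (range (L j)).
have xB n : cball (z n).1 (z n).2 x.
  move=> j; rewrite mxE.
  have H1 : L j n <= sup (range (L j)).
    by apply: ub_le_sup; [exists (M j 0%N) => _ [k _ <-]; exact: LM|by exists n].
  have H2 : sup (range (L j)) <= M j n.
    by apply: ge_sup; [exists (L j 0%N); exists 0%N|move=> _ [k _ <-]; exact: LM].
  rewrite /L /M in H1 H2; rewrite ler_norml; apply/andP; split; lra.
exists x; split=> [N|i Ux].
  have [_ _ _ [q [q0 Nq rq pq]]] := zS N; exists q; split=> // j.
  have [p pE] := pq j; exists p; have := xB N.+1 j.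
  have q0' : 0 < q%:R :> R by rewrite ltr0n.
  have -> : q%:R * x 0 j - p%:~R = q%:R * (x 0 j - (z N.+1).1 0 j).
    by rewrite pE; field; rewrite gt_eqF.
  rewrite normrM (gtr0_norm q0') => H.
  have -> : q%:R `^ (- tau) = q%:R * q%:R `^ (- (tau + 1)).
    rewrite -{2}(powRr1 (ltW q0')) -gt0_powRD //; congr (_ `^ _); lra.
  by rewrite ler_pM2l //; apply: le_trans H _.
have ai n : a i <= eta * (z n).2 `^ t.
  have [_ lz] := gz n; apply: le_trans (lz i.+1).
  rewrite big_mkcond big_ord_recr /= asboolT; last by exists x.
  rewrite lerDr; apply: sumr_ge0 => k _; case: ifP => // _; exact: ltW.
pose d := (a i / eta) `^ t^-1.
have d0 : 0 < d by rewrite powR_gt0 // divr_gt0.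
have dr n : d <= (z n).2.
  rewrite -[leRHS]powRr1 ?(ltW (r0 n)) // -(mulfV (lt0r_neq0 t0)) powRrM.
  apply: ler_powR2r; rewrite ?invr_ge0 ?divr_ge0 ?(ltW t0) ?(ltW (a0 i)) ?(ltW eta0) //.
  by rewrite ler_pdivrMr // mulrC.
have := rn (Num.truncn d^-1).
apply/negP; rewrite -ltNge; apply: (@lt_le_trans _ _ (d * (Num.truncn d^-1).+1%:R)).
  by rewrite -ltr_pdivrMl // mulr1 truncnS_gt.
by rewrite ler_pM2r.
Qed.

Local Open Scope classical_set_scope.
Local Open Scope ring_scope.

(** * Coverings and Hausdorff dimension *)

Section Norm.
Context {R : realType}.

Lemma coord_le_norm (n : nat) (x : 'rV[R]_n) j : `|x 0 j| <= `|x|.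
Proof.
rewrite [`|x|]mx_normrE (bigD1 (0, j)) //= le_max lexx //.
Qed.

Lemma norm_le_coord (n : nat) (x : 'rV[R]_n) e :
  0 <= e -> (forall j, `|x 0 j| <= e) -> `|x| <= e.
Proof.
move=> e0 xe; rewrite [`|x|]mx_normrE; apply/bigmax_leP; split=> // -[i j] _ /=.
by rewrite ord1.
Qed.
End Norm.

Section Hausdorff.
Context {R : realType} {V : normedModType R}.
Implicit Types (A U : set V) (t : R).
Local Open Scope ereal_scope.

Lemma diam_ge U x y : U x -> U y -> `|x - y|%:E <= diam U.
Proof. by move=> Ux Uy; apply: ereal_sup_ubound; exists (x, y). Qed.

Lemma diam_le U (D : R) : (forall x y, U x -> U y -> `|x - y| <= D)%R -> diam U <= D%:E.
Proof. by move=> H; apply: ge_ereal_sup => _ [[x y] [/= Ux Uy] <-]; rewrite lee_fin H. Qed.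

Lemma diam_pow_ge0 t U : 0 <= diam_pow t U.
Proof. by rewrite /diam_pow; case: ifP => // _; exact: poweR_ge0. Qed.

Lemma diam_pow_le t U (D : R) : (0 <= t)%R -> (0 <= D)%R ->
  (forall x y, U x -> U y -> `|x - y| <= D)%R -> diam_pow t U <= (D `^ t)%:E.
Proof.
move=> t0 D0 H; rewrite /diam_pow; case: eqP => [_|/eqP/set0P[x Ux]].
  by rewrite lee_fin powR_ge0.
have d0 : 0 <= diam U by apply: le_trans (diam_ge Ux Ux); rewrite lee_fin.
rewrite -poweR_EFin; apply: gt0_ler_poweR => //.
- by rewrite in_itv /= d0 leey.
- by rewrite in_itv /= lee_fin D0 leey.
- exact: diam_le.
Qed.

Lemma diam_pow_ge t U x y : (0 <= t)%R -> U x -> U y ->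
  (`|x - y| `^ t)%:E <= diam_pow t U.
Proof.
move=> t0 Ux Uy; rewrite /diam_pow; case: eqP => [U0|_]; first by rewrite U0 in Ux.
have d := diam_ge Ux Uy.
rewrite -poweR_EFin; apply: gt0_ler_poweR => //.
- by rewrite in_itv /= lee_fin normr_ge0 leey.
- by rewrite in_itv /= (le_trans _ d) ?leey // lee_fin.
Qed.

(** The weight of a covering set is increased by a term of a geometric series, so as
    to be positive even when the set is a single point. *)
Lemma hausdorff_measure_neq0 A t (eta : R) : (0 <= t)%R -> (0 < eta)%R ->
  (forall (U : nat -> set V) (a : nat -> R), (forall i, 0 < a i)%R ->
    (forall n, \sum_(i < n) a i <= eta)%R ->
    (forall i x y, U i x -> U i y -> `|x - y| `^ t <= a i)%R ->
    exists2 x, A x & forall i, ~ U i x) ->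
  hausdorff_measure t A <> 0.
Proof.
move=> t0 eta0 H HA.
have e2 : (0 < eta / 2)%R by rewrite divr_gt0.
have : hausdorff_content t 1 A < (eta / 2)%:E.
  apply: (@le_lt_trans _ _ 0); last by rewrite lte_fin.
  by rewrite -HA; apply: ereal_sup_ubound; exists 1%R => //=.
move=> /ereal_inf_lt[_ [F [AF F1] <-]] sF.
have F0 i : 0 <= diam_pow t (F i) by exact: diam_pow_ge0.
have part n : \sum_(0 <= i < n) diam_pow t (F i) < (eta / 2)%:E.
  by apply: le_lt_trans sF; apply: nneseries_lim_ge => *.
have Ffin i : diam_pow t (F i) \is a fin_num.
  rewrite ge0_fin_numE //; apply: (@le_lt_trans _ _ (\sum_(0 <= k < i.+1) diam_pow t (F k))).
    by rewrite big_nat_recr //= leeDr // sume_ge0.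
  by apply: (lt_trans (part _)); rewrite ltry.
pose a i := (fine (diam_pow t (F i)) + eta / 2 * (2 ^- i.+1))%R.
have [||i x y Fx Fy|x Ax Fx] := H F a.
- by move=> i; rewrite ltr_wpDl ?fine_ge0 // mulr_gt0 // invr_gt0 exprn_gt0.
- move=> n; rewrite big_split /= -mulr_sumr.
  have H1 : (\sum_(i < n) fine (diam_pow t (F i)) <= eta / 2)%R.
    rewrite -lee_fin -sumEFin; apply: le_trans (ltW (part n)).
    by rewrite big_mkord; apply: lee_sum => i _; rewrite fineK.
  have H2 : (\sum_(i < n) 2 ^- i.+1 <= 1 :> R)%R.
    have : (\sum_(i < n) 2 ^- i.+1 = 1 - 2 ^- n :> R)%R.
      elim: n {H1} => [|n IH]; first by rewrite big_ord0 expr0 invr1 subrr.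
      rewrite big_ord_recr /= IH exprS invfM; lra.
    by move=> ->; rewrite lerBlDr lerDl invr_ge0 exprn_ge0.
  have : (eta / 2 * \sum_(i < n) 2 ^- i.+1 <= eta / 2 * 1)%R by rewrite ler_pM2l.
  lra.
- apply: (@le_trans _ _ (fine (diam_pow t (F i)))).
    by rewrite -lee_fin fineK // diam_pow_ge.
  by rewrite lerDl mulr_ge0 ?invr_ge0 ?exprn_ge0 // ltW.
by have [i _ /Fx] := AF _ Ax.
Qed.

(** A cover organized in levels of finitely many sets becomes a sequence through a
    bijection between [nat] and [nat * nat], so that only the total content of each
    level has to be estimated. *)
Lemma hausdorff_measure_eq0 A t : (0 <= t)%R ->
  (forall delta eta : R, (0 < delta)%R -> (0 < eta)%R ->
    exists (N : nat -> nat) (L : nat -> nat -> set V) (D : nat -> R),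
    [/\ forall k, (0 <= D k <= delta)%R,
      forall k j x y, (j < N k)%N -> L k j x -> L k j y -> (`|x - y| <= D k)%R,
      forall k, ((N k)%:R * D k `^ t <= eta / (2 ^ k.+1)%:R)%R &
      forall x, A x -> exists k j, (j < N k)%N /\ L k j x]) ->
  hausdorff_measure t A = 0.
Proof.
move=> t0 H; apply/eqP; rewrite eq_le; apply/andP; split; last first.
  apply: (@le_trans _ _ (hausdorff_content t 1 A)); last first.
    by apply: ereal_sup_ubound; exists 1%R => //=.
  apply: le_ereal_inf_tmp => _ [F _ <-]; apply: nneseries_ge0 => *; exact: diam_pow_ge0.
apply: ge_ereal_sup => _ [delta /= d0 <-].
apply/lee_addgt0Pr => eta eta0; rewrite add0e.
have [N [L [D [D0 LD ND AL]]]] := H _ _ d0 eta0.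
pose G (kj : nat * nat) : set V := if (kj.2 < N kj.1)%N then L kj.1 kj.2 else set0.
have GD kj x y : G kj x -> G kj y -> (`|x - y| <= D kj.1)%R.
  by rewrite /G; case: ltnP => // jN; exact: LD.
have /card_esym/ppcard_eqP[f] := card_nat2.
apply: ge_ereal_inf; exists (\sum_(0 <= i <oo) diam_pow t (G (f i))).
  exists (G \o f) => //; split.
    move=> x Ax; have [k [j [jN Lx]]] := AL x Ax.
    by exists (f^-1%FUN (k, j)) => //=; rewrite invK ?inE // /G /= jN.
  move=> i; apply: (@le_trans _ _ (D (f i).1)%:E); last by rewrite lee_fin; case/andP: (D0 (f i).1).
  by apply: diam_le => x y; exact: GD.
have G0 kj : 0 <= diam_pow t (G kj) by exact: diam_pow_ge0.
rewrite nneseries_esumT // -(reindex_esum [set: nat] [set: nat * nat] f (fun kj => diam_pow t (G kj))) //.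
rewrite (_ : [set: nat * nat] = setT `*`` (fun=> setT)); last by apply/seteqP; split.
rewrite -(@esum_esum _ _ _ _ _ (fun i j => diam_pow t (G (i, j)))) //.
rewrite -nneseries_esumT; last by move=> n; apply: esum_ge0.
apply: le_trans (@epsilon_trick0 R eta xpredT (ltW eta0)).
apply: lee_nneseries => [k _ _|k _]; first by apply: esum_ge0.
apply: (@le_trans _ _ ((N k)%:R * D k `^ t)%:E); last by rewrite lee_fin ND.
rewrite -nneseries_esumT // (nneseries_split 0 (N k)) // add0n eseries0; last first.
  by move=> j jN _; rewrite /G /= ltnNge jN /= /diam_pow eqxx.
rewrite adde0.
apply: (@le_trans _ _ (\sum_(0 <= j < N k) (D k `^ t)%:E)).
  apply: lee_sum => j _; apply: diam_pow_le => //; first by case/andP: (D0 k).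
  by move=> x y; exact: GD.
by rewrite sumEFin lee_fin sumr_const_nat subn0 mulr_natl.
Qed.

End Hausdorff.

(** * Dimension of sets of well approximable points *)

Lemma approx_set0 (R : realType) (s : nat) (tau : R) : approx_set s tau (0 : 'rV[R]_s).
Proof.
apply/approx_setP => eps _ N; exists (maxn 1 N); split; [by rewrite leq_max|exact: leq_maxr|].
by move=> j; exists 0; rewrite mxE mulr0 subrr normr0 powR_ge0.
Qed.

(** The projection decreases distances, so a cover of [A] yields a family of sets
    in [R^s] to which [jarnik_avoid] applies. The exponent [0] is separate: there
    the weight of every nonempty set is [1]. *)
Lemma hausdorff_dim_ge (R : realType) (s n : nat) (tau : R) (A : set 'rV[R]_(s + n)) :
  (0 < s)%N -> 1 < tau -> approx_set s tau `<=` @proj_first R s n @` A ->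
  (((s%:R + 1) / (tau + 1))%:E <= hausdorff_dim A)%E.
Proof.
move=> s0 tau1 HA; apply: le_ereal_inf_tmp => _ [t [t0 Ht] <-].
rewrite lee_fin leNgt; apply/negP; rewrite ltr_pdivlMr; last by lra.
move=> tt; move: Ht.
have [t00|tn0] := eqVneq t 0.
  apply: (@hausdorff_measure_neq0 R _ A t (1 / 2)) => // U a a0 aeta Ua.
  have [z Az _] := HA _ (approx_set0 s tau); exists z => // i Uz.
  have := Ua _ _ _ Uz Uz; rewrite t00 powRr0 => a1.
  have := aeta i.+1; rewrite big_ord_recr /=.
  have : 0 <= \sum_(k < i) a k by apply: sumr_ge0 => k _; exact: ltW.
  lra.
have t0' : 0 < t by rewrite lt_neqAle eq_sym tn0.
have [eta eta0 H] := jarnik_avoid s0 tau1 t0' tt.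
apply: (@hausdorff_measure_neq0 R _ A t eta) => // U a a0 aeta Ua.
have [|x [xW xU]] := H (fun i => @proj_first R s n @` U i) a a0 aeta.
  move=> i _ _ [y Uy <-] [z Uz <-] j; apply: le_trans (Ua i y z Uy Uz).
  apply: ler_powR2r => //; have := coord_le_norm (y - z) (lshift n j).
  by rewrite /proj_first !mxE.
have [z Az zx] : (@proj_first R s n @` A) x.
  apply: HA; apply/approx_setP => eps eps0 N; have [q [q0 Nq Hq]] := xW N.
  exists q; split=> // j; have [p Hp] := Hq j; exists p; apply: (le_trans Hp).
  apply: ler_powR; first by rewrite ler1n.
  by rewrite lerDl ltW.
by exists z => // i Uz; apply: (xU i); exists z.
Qed.

Lemma shift_bounded (c : nat) (z : int) : (absz z <= c)%N ->
  (absz (z + c%:Z)%R < (2 * c).+1)%N /\ 0 <= z + c%:Z.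
Proof. by lia. Qed.

(** The set [approx_set s tau] is covered by the balls of radius
    [q `^ - (tau + 1 - eps)] around the rational points of denominator [q]; their
    images under [phi] have comparable diameters, since every [x] lies in the box of
    size [q `^ eps] as soon as [q] is large, and the Lipschitz constant of [phi] on
    this box is a small power of [q]. There are about [q `^ (s * (1 + eps))] such
    balls in this box. For [t] above the claimed value and [eps] small, the
    contribution of the denominators between [X] and [b * X] is of the order of
    [X `^ - sigma] for some [sigma > 0]; the base [b] is such that
    [b `^ sigma >= 2], so that the scales [X = b ^ (k + k0)] contribute at most a
    geometric series of ratio [1 / 2]. *)
Lemma hausdorff_dim_le (R : realType) (s n : nat) (tau : R)
    (phi : 'rV[R]_s -> 'rV[R]_n) (C e : R) (A : set 'rV[R]_n) :
  0 < tau -> 0 <= C -> 0 <= e ->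
  (forall (B d : R) (x y : 'rV[R]_s), 1 <= B -> 0 <= d ->
    (forall j, `|x 0 j| <= B /\ `|y 0 j| <= B /\ `|x 0 j - y 0 j| <= d) ->
    `|phi x - phi y| <= C * B `^ e * d) ->
  A `<=` phi @` approx_set s tau ->
  (hausdorff_dim A <= ((s%:R + 1) / (tau + 1))%:E)%E.
Proof.
move=> tau0 C0 e0 phiL HA.
have T0 : 0 < tau + 1 by rewrite addr_gt0.
apply/lee_addgt0Pr => h h0; rewrite -EFinD.
set t := (s%:R + 1) / (tau + 1) + h.
have t0 : 0 < t by rewrite addr_gt0 // divr_gt0 // ltr_wpDl.
apply: ereal_inf_lbound; exists t => //; split; first exact: ltW.
apply: hausdorff_measure_eq0; first exact: ltW.
move=> delta eta delta0 eta0.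
have gap0 : 0 < t * (tau + 1) - (s%:R + 1).
  rewrite /t mulrDl divfK ?gt_eqF // addrAC subrr add0r mulr_gt0 //.
have E0 : 0 < 1 + e by rewrite ltr_wpDr.
have S0 : 0 < s%:R + t * (1 + e) by rewrite ltr_wpDl // mulr_gt0.
(* The first term keeps the exponent [rr] of the diameters positive, the second
   one the exponent [sigma] of the contents. *)
pose eps := Num.min (tau / (2 * (1 + e))) ((t * (tau + 1) - (s%:R + 1)) / (2 * (s%:R + t * (1 + e)))).
have eps0 : 0 < eps.
  by rewrite lt_min; apply/andP; split; apply: divr_gt0 => //; apply: mulr_gt0.
have eps1 : eps * (1 + e) <= tau / 2.
  have : eps <= tau / (2 * (1 + e)) by rewrite ge_min lexx.
  rewrite ler_pdivlMr ?mulr_gt0 //; lra.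
have eps2 : eps * (s%:R + t * (1 + e)) <= (t * (tau + 1) - (s%:R + 1)) / 2.
  have : eps <= (t * (tau + 1) - (s%:R + 1)) / (2 * (s%:R + t * (1 + e))).
    by rewrite ge_min lexx orbT.
  rewrite ler_pdivlMr ?mulr_gt0 //; lra.
have eps3 : eps <= tau / 2.
  apply: le_trans eps1; rewrite ler_peMr ?(ltW eps0) //; lra.
pose sigma := t * (tau + 1) - (s%:R + 1) - eps * (s%:R + t * (1 + e)).
have sig0 : 0 < sigma by rewrite /sigma; lra.
pose rr := tau + 1 - eps * (1 + e).
have rr0 : 0 < rr by rewrite /rr; lra.
have [b1 Hb1] := natr_powR_large 2 sig0.
pose b := maxn 2 b1.
have b2 : (2 <= b)%N by exact: leq_maxl.
have bs : 2 <= b%:R `^ sigma by apply: Hb1; exact: leq_maxr.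
have b0 : 0 < b%:R :> R by rewrite ltr0n (leq_trans _ b2).
have b1' : 1 <= b%:R :> R by rewrite ler1n (leq_trans _ b2).
pose C1 := C * (b%:R `^ eps) `^ e * 2.
have C10 : 0 <= C1 by rewrite !mulr_ge0 ?powR_ge0.
pose C2 := b%:R * (5 * b%:R `^ (1 + eps)) ^+ s.
have C20 : 0 <= C2 by rewrite mulr_ge0 ?exprn_ge0 ?mulr_ge0 ?powR_ge0.
have [k1 Hk1] := natr_powR_large (C1 / delta) rr0.
have [k2 Hk2] := natr_powR_large (2 * (C2 * C1 `^ t) / eta) (@ltr01 R).
pose k0 := maxn k1 k2.
pose X k : nat := (b ^ (k + k0))%N.
have X0 k : 0 < (X k)%:R :> R by rewrite ltr0n expn_gt0 (leq_trans _ b2).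
have X1 k : 1 <= (X k)%:R :> R by rewrite ler1n expn_gt0 (leq_trans _ b2).
pose W k : R := ((b * X k)%N)%:R.
have W0 k : 0 < W k by rewrite /W natrM mulr_gt0.
have W1 k : 1 <= W k by rewrite /W natrM (le_trans b1') // ler_peMr // ltW.
pose Pk k := Num.truncn (2 * W k `^ (1 + eps)).
pose T k := ('I_(b * X k) * {ffun 'I_s -> 'I_(2 * Pk k).+1})%type.
pose F k (ig : T k) : set 'rV[R]_n := phi @` [set x : 'rV[R]_s | forall j,
  `|x 0 j| <= W k `^ eps /\
  `|(X k + ig.1)%N%:R * x 0 j - ((ig.2 j)%:R - (Pk k)%:R)| <= (X k)%:R `^ (- tau + eps)].
pose N k := #|{: T k}|.
pose L k j : set 'rV[R]_n := nth set0 [seq F k ig | ig <- enum {: T k}] j.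
pose D k := C1 * (X k)%:R `^ (- rr).
exists N, L, D; split.
- move=> k; rewrite mulr_ge0 ?powR_ge0 //= /D powRN.
  rewrite ler_pdivrMr ?powR_gt0 // mulrC -ler_pdivrMr //; apply: Hk1.
  apply: (leq_trans (leq_maxl k1 k2)); apply: (leq_trans (leq_addl k _)).
  by apply: ltnW; apply: ltn_expl.
- move=> k j u v jN; rewrite /L (nth_map (enum_default (Ordinal jN))) -?cardT //.
  set ig := nth _ _ _; move=> [x Hx <-] [y Hy <-].
  have q0 : 0 < (X k + ig.1)%N%:R :> R.
    by apply: lt_le_trans (X0 k) _; rewrite ler_nat leq_addr.
  have d0 : 0 <= 2 * (X k)%:R `^ (- tau + eps) / (X k)%:R by rewrite divr_ge0 ?mulr_ge0 ?powR_ge0.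
  have We : 1 <= W k `^ eps by rewrite -[leLHS](powRr0 (W k)) ler_powR // ltW.
  apply: (le_trans (phiL (W k `^ eps) (2 * (X k)%:R `^ (- tau + eps) / (X k)%:R) x y We d0 _)).
    move=> l; have [x1 x2] := Hx l; have [y1 y2] := Hy l; split=> //; split=> //.
    rewrite ler_pdivlMr //; apply: (@le_trans _ _ (`|x 0 l - y 0 l| * (X k + ig.1)%N%:R)).
      by rewrite ler_wpM2l // ler_nat leq_addr.
    rewrite -[X in _ * X](gtr0_norm q0) -normrM.
    move: x2 y2; rewrite !ler_norml => /andP[xl xu] /andP[yl yu].
    by clear - xl xu yl yu; apply/andP; split; lra.
  suff -> : C * (W k `^ eps) `^ e * (2 * (X k)%:R `^ (- tau + eps) / (X k)%:R) = D k by [].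
  rewrite /D /C1 /W natrM powRM ?(ltW b0) ?(ltW (X0 k)) // powRM ?powR_ge0 // -[2 * _ / _]mulrA.
  have -> : (X k)%:R `^ (- rr) = ((X k)%:R `^ eps) `^ e * ((X k)%:R `^ (- tau + eps) / (X k)%:R).
    rewrite -powRrM -[X in _ / X](powRr1 (ltW (X0 k))) -powRN -!gt0_powRD //.
    by congr (_ `^ _); rewrite /rr; ring.
  move: ((b%:R `^ eps) `^ e) (((X k)%:R `^ eps) `^ e) ((X k)%:R `^ (- tau + eps) / (X k)%:R).
  by move=> u1 u2 u3; ring.
- move=> k; rewrite /N card_prod card_ord card_ffun !card_ord natrM natrX -/(W k).
  have PW : (2 * Pk k).+1%:R <= 5 * W k `^ (1 + eps).
    have : (Pk k)%:R <= 2 * W k `^ (1 + eps) by rewrite truncn_le mulr_ge0 ?powR_ge0.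
    have : 1 <= W k `^ (1 + eps) by rewrite -[leLHS](powRr0 (W k)) ler_powR // ltW // addr_gt0.
    rewrite -(natr1 (2 * Pk k)) natrM; clear; lra.
  have H1 : W k * (2 * Pk k).+1%:R ^+ s <= C2 * (X k)%:R `^ (1 + s%:R * (1 + eps)).
    apply: (@le_trans _ _ (W k * (5 * W k `^ (1 + eps)) ^+ s)).
      by rewrite ler_pM2l // lerXn2r ?nnegrE // mulr_ge0 ?powR_ge0.
    rewrite /C2 (gt0_powRD 1 (s%:R * (1 + eps)) (X0 k)) powRr1 ?(ltW (X0 k)) //.
    have -> : W k = b%:R * (X k)%:R by rewrite /W natrM.
    rewrite powRM ?(ltW b0) ?(ltW (X0 k)) //.
    rewrite [s%:R * _]mulrC powRrM powR_mulrn ?powR_ge0 //.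
    rewrite le_eqVlt; apply/orP; left; apply/eqP.
    rewrite !exprMn; ring.
  have H2 : D k `^ t = C1 `^ t * (X k)%:R `^ (- rr * t).
    by rewrite /D powRM ?powR_ge0 // powRrM.
  rewrite H2; apply: (@le_trans _ _ (C2 * (X k)%:R `^ (1 + s%:R * (1 + eps)) * (C1 `^ t * (X k)%:R `^ (- rr * t)))).
    by rewrite ler_wpM2r // mulr_ge0 ?powR_ge0.
  have -> : C2 * (X k)%:R `^ (1 + s%:R * (1 + eps)) * (C1 `^ t * (X k)%:R `^ (- rr * t)) =
     C2 * C1 `^ t * (X k)%:R `^ (- sigma).
    have -> : - sigma = (1 + s%:R * (1 + eps)) + (- rr * t) by rewrite /sigma /rr; ring.
    by rewrite (gt0_powRD (1 + s%:R * (1 + eps)) (- rr * t) (X0 k)); ring.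
  have H3 : 2 ^+ (k + k0) <= (X k)%:R `^ sigma.
    rewrite /X natrX -powR_mulrn ?(ltW b0) // -powRrM mulrC powRrM powR_mulrn ?powR_ge0 //.
    by rewrite lerXn2r ?nnegrE ?powR_ge0.
  rewrite powRN ler_pdivrMr ?powR_gt0 //.
  have H4 : 2 * (C2 * C1 `^ t) <= eta * 2 ^+ k0.
    rewrite [leRHS]mulrC -ler_pdivrMr //; apply: (@le_trans _ _ (k0%:R `^ 1)).
      exact/Hk2/leq_maxr.
    by rewrite powRr1 // -natrX ler_nat ltnW // ltn_expl.
  apply: (@le_trans _ _ (eta / (2 ^ k.+1)%:R * 2 ^+ (k + k0))); last first.
    by rewrite ler_wpM2l // divr_ge0 // ltW.
  have -> : eta / (2 ^ k.+1)%:R * 2 ^+ (k + k0) = eta * 2 ^+ k0 / 2.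
    rewrite natrX exprD exprS; field; by rewrite expf_neq0.
  by rewrite ler_pdivlMr //; clear - H4; lra.
move=> z /HA[x /approx_setP xW <-].
have [B HB] : exists B : nat, forall j, `|x 0 j| <= B%:R.
  exists (Num.truncn `|x|).+1 => j; apply: (le_trans (coord_le_norm x j)).
  by apply/ltW; exact: truncnS_gt.
have [q1 Hq1] := natr_powR_large B%:R eps0.
have [q [q0 Nq Hq]] := xW eps eps0 (maxn (b ^ k0) q1).
pose K := trunc_log b q.
have k0K : (k0 <= K)%N by apply: trunc_log_max => //; apply: leq_trans Nq; exact: leq_maxl.
have /andP[bK1 bK2] := trunc_log_bounds b2 q0; rewrite -/K in bK1 bK2.
pose k := (K - k0)%N; exists k.
have XE : X k = (b ^ K)%N by rewrite /X /k subnK.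
have qX : (X k <= q)%N by rewrite XE.
have qW : (q < b * X k)%N by rewrite XE -expnS.
have qW' : q%:R <= W k by rewrite ler_nat ltnW.
have q0' : 0 < q%:R :> R by rewrite ltr0n.
have xW' j : `|x 0 j| <= W k `^ eps.
  apply: (le_trans (HB j)); apply: (@le_trans _ _ (q%:R `^ eps)).
    by apply: Hq1; apply: leq_trans Nq; exact: leq_maxr.
  by apply: ler_powR2r => //; exact: ltW.
have qt1 : q%:R `^ (- tau + eps) <= (X k)%:R `^ (- tau + eps).
  have -> : - tau + eps = - (tau - eps) by ring.
  by apply: ler_powRN2r; rewrite ?ler_nat //; clear - eps3 tau0; lra.
have Xt1 : (X k)%:R `^ (- tau + eps) <= 1.
  by rewrite -[leRHS](powRr0 (X k)%:R) ler_powR //; clear - eps3 tau0; lra.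
have /choice[p pP] := Hq.
have pW j : `|(p j)%:~R| <= 2 * W k `^ (1 + eps).
  have -> : (p j)%:~R = q%:R * x 0 j - (q%:R * x 0 j - (p j)%:~R) :> R by ring.
  apply: (le_trans (ler_normB _ _)); rewrite normrM (gtr0_norm q0').
  have H1 : q%:R * `|x 0 j| <= W k * W k `^ eps by apply: ler_pM => //; exact: ltW.
  have H2 : W k `^ (1 + eps) = W k * W k `^ eps by rewrite gt0_powRD // powRr1 // ltW.
  have : 1 <= W k `^ (1 + eps) by rewrite -[leLHS](powRr0 (W k)) ler_powR // ltW // addr_gt0.
  have := pP j; rewrite H2 in H1 *; clear - H1 qt1 Xt1; lra.
have pP' j : (`|p j| <= Pk k)%N.
  by rewrite /Pk truncn_ge_nat ?mulr_ge0 ?powR_ge0 // natr_absz intr_norm.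
have iq : (q - X k < b * X k)%N by apply: leq_ltn_trans qW; exact: leq_subr.
pose ig : T k := (Ordinal iq, [ffun j => inord (absz (p j + (Pk k)%:Z))]).
exists (index ig (enum {: T k})); split.
  by rewrite /N cardT index_mem mem_enum.
rewrite /L (nth_map ig) ?index_mem ?mem_enum // nth_index ?mem_enum //.
exists x => // j; split=> //=.
rewrite (subnKC qX) ffunE inordK; last first.
  by have [] := shift_bounded (pP' j).
have -> : (absz (p j + (Pk k)%:Z))%:R = (p j)%:~R + (Pk k)%:R :> R.
  rewrite natr_absz ger0_norm; first by rewrite intrD.
  by have [] := shift_bounded (pP' j).
by rewrite addrK; apply: le_trans qt1.
Qed.

(** * Values of integer polynomials at rational points *)

Section Lipschitz.
Context {R : realType}.

(** Only the polynomial growth in [B] matters, not the exponent; the bound on the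
    values is there to make the induction work. *)
Lemma poly_lipschitz (p : {poly R}) : exists (C : R) (e : nat), 0 <= C /\
  forall B x y : R, 1 <= B -> `|x| <= B -> `|y| <= B ->
    `|p.[x]| <= C * B ^+ e /\ `|p.[x] - p.[y]| <= C * B ^+ e * `|x - y|.
Proof.
elim/poly_ind: p => [|p c [C [e [C0 IH]]]].
  by exists 0, 0%N; split => // B x y _ _ _; rewrite !horner0 subrr normr0 !mul0r.
exists (2 * C + `|c|), e.+1; split; first by rewrite addr_ge0 // mulr_ge0.
move=> B x y B1 xB yB; have [px pxy] := IH B x y B1 xB yB.
have [py _] := IH B y x B1 yB xB.
have B0 : 0 <= B by rewrite (le_trans ler01).
have Be : 1 <= B ^+ e.+1 by rewrite exprn_ege1.
have CB : 0 <= C * B ^+ e.+1 by rewrite mulr_ge0 // exprn_ge0.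
have cB : `|c| <= `|c| * B ^+ e.+1 by rewrite ler_peMr.
rewrite !hornerE; split.
  apply: (le_trans (ler_normD _ _)); rewrite normrM mulrDl; apply: lerD => //.
  apply: (@le_trans _ _ (C * B ^+ e * B)); first by rewrite ler_pM.
  rewrite -mulrA -exprSr mulrDl; lra.
have -> : p.[x] * x + c - (p.[y] * y + c) = (p.[x] - p.[y]) * x + p.[y] * (x - y) by ring.
apply: (le_trans (ler_normD _ _)); rewrite !normrM.
have H1 : `|p.[x] - p.[y]| * `|x| <= C * B ^+ e.+1 * `|x - y|.
  apply: (@le_trans _ _ (C * B ^+ e * `|x - y| * B)); first by rewrite ler_pM.
  by rewrite exprSr mulrAC mulrA.
have H2 : `|p.[y]| * `|x - y| <= C * B ^+ e.+1 * `|x - y|.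
  rewrite ler_wpM2r //; apply: (le_trans py); rewrite ler_wpM2l // ler_weXn2l //.
have H3 : 0 <= `|c| * B ^+ e.+1 * `|x - y| by rewrite !mulr_ge0 // exprn_ge0.
lra.
Qed.

Lemma polys_lipschitz (s : nat) (p : 'I_s -> {poly R}) : exists (C : R) (e : nat), 1 <= C /\
  forall i (B x y : R), 1 <= B -> `|x| <= B -> `|y| <= B ->
    `|(p i).[x] - (p i).[y]| <= C * B ^+ e * `|x - y|.
Proof.
have /choice[C] := fun i => poly_lipschitz (p i).
move=> /choice[e H].
have C0 i : 0 <= C i by case: (H i).
exists (1 + \sum_i C i), (\sum_i e i)%N; split; first by rewrite lerDl sumr_ge0.
move=> i B x y B1 xB yB; have [_ /(_ B x y B1 xB yB)[_]] := H i.
move=> /le_trans; apply; rewrite ler_wpM2r //.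
have B0 : 0 <= B by rewrite (le_trans ler01).
apply: ler_pM => //; first by rewrite exprn_ge0.
  by rewrite (bigD1 i) //= addrCA lerDl addr_ge0 // sumr_ge0.
by rewrite ler_weXn2l // (bigD1 i) //= leq_addr.
Qed.
End Lipschitz.

Section Homogenization.

(** The homogenization of [p] in degree [D]. *)
Definition hom (p : {poly int}) (D : nat) (a b : int) : int :=
  \sum_(i < D.+1) p`_i * a ^+ i * b ^+ (D - i).

Lemma homE (R : realType) (p : {poly int}) (D : nat) (a b : int) :
  (degree p <= D)%N -> b != 0 ->
  b%:~R ^+ D * (map_poly intr p).[a%:~R / b%:~R] = (hom p D a b)%:~R :> R.
Proof.
move=> pD b0; have b0' : b%:~R != 0 :> R by rewrite intr_eq0.
have sD : (size (map_poly intr p : {poly R}) <= D.+1)%N.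
  apply: leq_trans (size_poly _ _) _; by move: pD; rewrite /degree; case: (size p).
rewrite (horner_coef_wide _ sD) mulr_sumr rmorph_sum /=; apply: eq_bigr => i _.
rewrite coef_map_id0 // !intrM !rmorphXn /= exprMn exprVn.
have -> : b%:~R ^+ D = b%:~R ^+ i * b%:~R ^+ (D - i) :> R.
  by rewrite -exprD subnKC // -ltnS.
by field; rewrite expf_neq0.
Qed.

Lemma hom_lead (p : {poly int}) (a b : int) :
  exists h, hom p (degree p) a b = lead_coef p * a ^+ degree p + b * h.
Proof.
exists (\sum_(i < degree p) p`_i * a ^+ i * b ^+ (degree p - i).-1).
rewrite /hom big_ord_recr /= subnn expr0 mulr1 addrC lead_coefE; congr (_ + _).
rewrite mulr_sumr; apply: eq_bigr => i _.
have -> : (degree p - i)%N = (degree p - i).-1.+1 by have := ltn_ord i; lia.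
by rewrite exprS /=; ring.
Qed.
End Homogenization.

(** Write [p / q = a / b] in lowest terms, [q = b * g], and [m] for the degree. Then
    [b ^ m * P(a / b)] is an integer [N], and [g * N - n * b ^ m.-1] is an integer of
    absolute value less than [1], so [q * N = n * b ^ m]. As [N] is congruent to
    [lead_coef P * a ^ m] modulo [b], the gcd of [N] and [b] divides [lead_coef P], and
    by Bezout its [m]-th power is a combination of [N] and [b ^ m]. *)
Lemma denom_dvd (R : realType) (P : {poly int}) (q : nat) (p n : int) :
  (0 < q)%N -> (1 <= degree P)%N ->
  `|q%:R * (map_poly intr P).[p%:~R / q%:R] - n%:~R| * q%:R ^+ (degree P).-1 < 1 :> R ->
  (((q %/ gcdn `|p| q) ^ degree P) %| q * `|lead_coef P| ^ degree P)%N.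
Proof.
move=> q0 dg H; set g := gcdn _ _; set b := (q %/ g)%N; set m := degree P.
have g0 : (0 < g)%N by rewrite gcdn_gt0 q0 orbT.
have qE : q = (b * g)%N by rewrite divnK // dvdn_gcdr.
have b0 : (0 < b)%N by move: q0; rewrite qE muln_gt0 => /andP[].
have bq : (b <= q)%N by rewrite qE leq_pmulr.
have [a pE] : exists a : int, p = a * g%:Z.
  have /dvdzP[a aE] : (g%:Z %| p)%Z by rewrite dvdzE /= dvdn_gcdl.
  by exists a.
have cab : coprimez a b%:Z.
  rewrite coprimezE /= /coprime -(eqn_pmul2r g0) mul1n muln_gcdl -qE.
  by rewrite -[X in (_ * X)%N]/(`|g%:Z|%N) -abszM -pE.
have b0' : b%:R != 0 :> R by rewrite pnatr_eq0 -lt0n.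
have g0' : g%:R != 0 :> R by rewrite pnatr_eq0 -lt0n.
set N := hom P m a b.
have pq : p%:~R / q%:R = a%:~R / b%:~R :> R.
  rewrite pE {1}qE intrM natrM -!pmulrn; field; by rewrite g0' b0'.
have HN : b%:R ^+ m * (map_poly intr P).[p%:~R / q%:R] = N%:~R :> R.
  by rewrite pq [b%:R]pmulrn homE //; apply/eqP; lia.
have gN : g%:Z * N - n * b%:Z ^+ m.-1 = 0.
  apply/eqP; rewrite -absz_eq0 -leqn0 -ltnS -(ltr_nat R) natr_absz intr_norm.
  apply: le_lt_trans H.
  have -> : (g%:Z * N - n * b%:Z ^+ m.-1)%:~R =
     (q%:R * (map_poly intr P).[p%:~R / q%:R] - n%:~R) * b%:R ^+ m.-1 :> R.
    have bm : b%:R ^+ m = b%:R * b%:R ^+ m.-1 :> R by rewrite -exprS prednK.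
    rewrite intrB !intrM -HN rmorphXn /= -!pmulrn bm; move: (_.[_]) => y.
    have -> : q%:R = b%:R * g%:R :> R by rewrite -natrM -qE.
    ring.
  rewrite normrM ler_wpM2l // ger0_norm ?exprn_ge0 // lerXn2r ?nnegrE // ler_nat //.
have qN : q%:Z * N = n * b%:Z ^+ m.
  have -> : b%:Z ^+ m = b%:Z * b%:Z ^+ m.-1 by rewrite -exprS prednK.
  have e : g%:Z * N = n * b%:Z ^+ m.-1 by apply/eqP; rewrite -subr_eq0 gN.
  by rewrite {1}qE PoszM -mulrA e mulrCA.
have [h NE] := hom_lead P a b; rewrite -/m -/N in NE.
have W1 : (gcdz N b %| lead_coef P)%Z.
  have cWa : coprimez (gcdz N b) (a ^+ m).
    rewrite coprimezXr // coprimez_sym.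
    exact: (coprimez_dvdr (dvdz_gcdr N b) cab).
  rewrite -(Gauss_dvdzl _ cWa).
  have -> : lead_coef P * a ^+ m = N - b%:Z * h by rewrite NE; ring.
  by apply: rpredB; [exact: dvdz_gcdl|apply: dvdz_mulr; exact: dvdz_gcdr].
have [u [v uv]] := Bezoutz N b.
have W2 : (b%:Z ^+ m %| q%:Z * gcdz N b ^+ m)%Z.
  rewrite -uv -[(u * N + v * b%:Z) ^+ m](subrK ((v * b%:Z) ^+ m)) subrXX.
  rewrite mulrDr; apply: rpredD; last first.
    by rewrite exprMn; apply/dvdz_mull/dvdz_mull.
  rewrite addrK mulrA [u * N]mulrC [q%:Z * _]mulrA qN.
  by rewrite -!mulrA; apply/dvdz_mull/dvdz_mulr.
have := dvdz_trans W2 (dvdz_mul (dvdzz q%:Z) (dvdz_exp2r m W1)).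
by rewrite dvdzE abszM !abszX.
Qed.

Lemma lcmn_exp_dvd (d X m n : nat) :
  (m ^ d %| X -> n ^ d %| X -> lcmn m n ^ d %| X)%N.
Proof.
have [g0|g0] := posnP (gcdn m n).
  have /andP[/eqP-> /eqP->] : (m == 0)%N && (n == 0)%N.
    by rewrite !eqn0Ngt -negb_or -gcdn_gt0 g0.
  move=> X0 _; rewrite lcm0n; exact: X0.
set g := gcdn m n in g0 *.
have mE : m = (m %/ g * g)%N by rewrite divnK // dvdn_gcdl.
have nE : n = (n %/ g * g)%N by rewrite divnK // dvdn_gcdr.
have co : coprime (m %/ g) (n %/ g).
  by rewrite /coprime -(eqn_pmul2r g0) mul1n muln_gcdl -mE -nE.
have -> : lcmn m n = (m %/ g * (n %/ g) * g)%N.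
  by rewrite /lcmn -/g {1}mE {1}nE mulnACA mulnA mulnK.
rewrite {1}mE {1}nE => /[dup] /(dvdn_trans _) gX.
have /gX : (g ^ d %| (m %/ g * g) ^ d)%N by rewrite expnMn dvdn_mull.
move=> /dvdnP[Y ->]; rewrite !expnMn !dvdn_pmul2r ?expn_gt0 ?g0 // => mY nY.
by rewrite Gauss_dvd ?mY // coprimeXl // coprimeXr.
Qed.

(** * Approximation on the graph *)

Definition graph_point (R : realType) (s : nat) (P : 'I_s -> {poly int}) (x : 'rV[R]_s) :
  'rV[R]_(s + s) := row_mx x (\row_i (map_poly intr (P i)).[x 0 i]).

Lemma approx_graphP (R : realType) (s : nat) (P : 'I_s -> {poly int}) (lambda : R) (x : 'rV[R]_s) :
  approx_set (s + s) lambda (graph_point P x) <->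
  forall eps : R, 0 < eps -> forall N : nat, exists q : nat, [/\ (0 < q)%N, (N <= q)%N,
    forall j, exists p : int, `|q%:R * x 0 j - p%:~R| <= q%:R `^ (- lambda + eps) &
    forall j, exists n : int,
      `|q%:R * (map_poly intr (P j)).[x 0 j] - n%:~R| <= q%:R `^ (- lambda + eps)].
Proof.
rewrite approx_setP; split=> h eps eps0 N.
  have [q [q0 Nq hq]] := h eps eps0 N; exists q; split=> // j.
    by have := hq (lshift s j); rewrite row_mxEl.
  by have := hq (rshift s j); rewrite row_mxEr mxE.
have [q [q0 Nq h1 h2]] := h eps eps0 N; exists q; split=> // j.
by case: (split_ordP j) => k ->; rewrite ?row_mxEl // row_mxEr mxE.
Qed.

Lemma graph_lipschitz_near (R : realType) (s : nat) (P : 'I_s -> {poly int}) (x : 'rV[R]_s) :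
  exists2 K : R, 1 <= K & forall j (y : R), `|x 0 j - y| <= 1 ->
    `|(map_poly intr (P j)).[x 0 j] - (map_poly intr (P j)).[y]| <= K * `|x 0 j - y|.
Proof.
have [C [e [C1 H]]] := polys_lipschitz (fun i => map_poly intr (P i) : {poly R}).
exists (C * (`|x| + 1) ^+ e).
  by rewrite mulr_ege1 // exprn_ege1 // lerDr.
move=> j y xy; have xj := coord_le_norm x j.
apply: H; [by rewrite lerDr|lra|].
have -> : y = x 0 j - (x 0 j - y) by lra.
apply: (le_trans (ler_normB _ _)); lra.
Qed.

(** The multiplier [q ^ D] clears the denominators of all the [P i] at [p / q], and
    it loses a factor [q ^ D.-1] on the approximation of [x] itself. *)
Lemma approx_graph (R : realType) (s : nat) (P : 'I_s -> {poly int}) (D : nat)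
    (lambda : R) (x : 'rV[R]_s) :
  (0 < D)%N -> (forall i, degree (P i) <= D)%N -> 0 < lambda ->
  approx_set s (D%:R * lambda + D%:R - 1) x ->
  approx_set (s + s) lambda (graph_point P x).
Proof.
move=> D0 PD l0 /approx_setP xA; apply/approx_graphP => eps eps0 N.
have D1 : 1 <= D%:R :> R by rewrite ler1n.
have Dl : 0 < D%:R * lambda by rewrite mulr_gt0 // (lt_le_trans ltr01).
pose e1 := Num.min (eps / 2) 1.
have e10 : 0 < e1 by rewrite lt_min ltr01 andbT divr_gt0.
have e1e : e1 <= eps / 2 by rewrite ge_min lexx.
have e11 : e1 <= 1 by rewrite ge_min lexx orbT.
have [K K1 HK] := graph_lipschitz_near P x.
have [q1 Hq1] := natr_powR_large K (divr_gt0 eps0 (ltr0Sn R 1)).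
have [q [q0 Nq Hq]] := xA e1 e10 (maxn N q1).
have q0' : 0 < q%:R :> R by rewrite ltr0n.
have qge1 : 1 <= q%:R :> R by rewrite ler1n.
have Kq : K <= q%:R `^ (eps / 2) by apply/Hq1/(leq_trans _ Nq)/leq_maxr.
pose E : R := - (D%:R * lambda) + e1.
have EE : q%:R `^ (- (D%:R * lambda + D%:R - 1) + e1) = q%:R `^ E / q%:R ^+ D.-1.
  rewrite -powR_mulrn ?(ltW q0') // -powRN -gt0_powRD //; congr (_ `^ _).
  by rewrite /E -subn1 natrB //; ring.
have goalE y : y <= K * q%:R `^ E -> y <= (q ^ D)%N%:R `^ (- lambda + eps).
  move=> /le_trans; apply; apply: (@le_trans _ _ (q%:R `^ (eps / 2) * q%:R `^ E)).
    by rewrite ler_wpM2r // powR_ge0.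
  rewrite -gt0_powRD // natrX -powR_mulrn ?(ltW q0') // -powRrM; apply: ler_powR => //.
  have : 1 * eps <= D%:R * eps by rewrite ler_pM2r.
  rewrite /E; lra.
have Eone : K * q%:R `^ E >= q%:R `^ E by rewrite ler_peMl // powR_ge0.
exists (q ^ D)%N; split.
- by rewrite expn_gt0 q0.
- apply: (leq_trans (leq_maxl N q1)); apply: (leq_trans Nq).
  by rewrite -[X in (X <= _)%N]expn1 leq_pexp2l.
- move=> j; have [p Hp] := Hq j; exists (p * q%:Z ^+ D.-1); apply: goalE.
  apply: le_trans Eone.
  have -> : (q ^ D)%N%:R * x 0 j - (p * q%:Z ^+ D.-1)%:~R =
      (q%:R * x 0 j - p%:~R) * q%:R ^+ D.-1.
    by rewrite natrX intrM [(q%:Z ^+ _)%:~R]rmorphXn /= -[in LHS](prednK D0) exprS; ring.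
  rewrite normrM (ger0_norm (exprn_ge0 _ (ltW q0'))) -ler_pdivlMr ?exprn_gt0 //.
  by rewrite -EE.
move=> j; have [p Hp] := Hq j; exists (hom (P j) D p q); apply: goalE.
have qz : q%:Z != 0 by rewrite eqz_nat -lt0n.
have hE := @homE R (P j) D p q (PD j) qz.
rewrite -pmulrn in hE.
have xy : `|x 0 j - p%:~R / q%:R| <= q%:R `^ E / q%:R ^+ D.
  have -> : x 0 j - p%:~R / q%:R = (q%:R * x 0 j - p%:~R) / q%:R.
    by field; rewrite gt_eqF.
  rewrite normrM normfV (gtr0_norm q0') ler_pdivrMr //.
  by rewrite -{1}(prednK D0) exprSr invfM mulrA mulrVK ?unitfE ?gt_eqF // -EE.
have xy1 : `|x 0 j - p%:~R / q%:R| <= 1.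
  apply: (le_trans xy); rewrite ler_pdivrMr ?exprn_gt0 // mul1r.
  rewrite -powR_mulrn ?(ltW q0') //; apply: ler_powR => //; rewrite /E; lra.
rewrite -hE natrX -mulrBr normrM (ger0_norm (exprn_ge0 _ (ltW q0'))).
rewrite mulrC -ler_pdivlMr ?exprn_gt0 //; apply: (le_trans (HK j _ xy1)).
by rewrite -mulrA ler_wpM2l // (le_trans ler01).
Qed.

(** By [denom_dvd], the reduced denominators [b j] of the coordinates of [p / q]
    satisfy [b j ^ d %| q * L], and so does their least common multiple [Q]. *)
Lemma common_denominator (R : realType) (s : nat) (P : 'I_s -> {poly int}) (d : nat)
    (lambda : R) (x : 'rV[R]_s) :
  (forall i, (1 <= degree (P i))%N /\ (d <= degree (P i))%N) ->
  (forall i, (degree (P i))%:R - 1 < lambda) ->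
  approx_set (s + s) lambda (graph_point P x) ->
  exists2 L : nat, (0 < L)%N & exists2 delta0 : R, 0 < delta0 &
  forall delta, 0 < delta -> delta <= delta0 -> forall M : nat, exists (q Q : nat),
    [/\ (M <= q)%N, (0 < Q)%N, (Q ^ d <= q * L)%N &
      forall j, exists a : int, `|Q%:R * x 0 j - a%:~R| <= Q%:R * q%:R `^ (- (lambda + 1 - delta))].
Proof.
move=> Pd Pl /approx_graphP xA.
pose L := (\prod_i `|lead_coef (P i)| ^ degree (P i))%N.
have L0 : (0 < L)%N.
  rewrite prodn_gt0 // => i; rewrite expn_gt0 absz_gt0 lead_coef_eq0.
  apply/orP; left; apply/eqP => P0; have [] := Pd i.
  by rewrite /degree P0 size_poly0.
exists L => //.
have [K K1 HK] := graph_lipschitz_near P x.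
(* Half of the margin in [degree (P i) - 1 < lambda] absorbs [delta], the other half
   the constant [K + 1]. *)
have [d0 d00 Hd0] : exists2 d0 : R, 0 < d0 & forall i, (degree (P i))%:R - 1 + 2 * d0 <= lambda.
  exists (\big[Num.min/1]_i ((lambda - ((degree (P i))%:R - 1)) / 2)).
    by apply/bigmin_gtP; split => // i _; have := Pl i; lra.
  move=> i; have : \big[Num.min/1]_i ((lambda - ((degree (P i))%:R - 1)) / 2) <=
      (lambda - ((degree (P i))%:R - 1)) / 2 by exact: bigmin_le.
  lra.
exists (Num.min d0 1); first by rewrite lt_min d00 ltr01.
move=> delta delta0; rewrite le_min => /andP[dd0 dd1] M.
have [q1 Hq1] := natr_powR_large (K + 2) d00.
have [q [q0 Mq Hq1' Hq2']] := xA delta delta0 (maxn M q1).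
have q0' : 0 < q%:R :> R by rewrite ltr0n.
have qge1 : 1 <= q%:R :> R by rewrite ler1n.
have Kq : K + 2 <= q%:R `^ d0 by apply/Hq1/(leq_trans _ Mq)/leq_maxr.
have /choice[p Hp] := Hq1'; have /choice[n Hn] := Hq2'.
pose g j := gcdn `|p j| q; pose b j := (q %/ g j)%N.
have Ek : q%:R * q%:R `^ (- (lambda + 1 - delta)) = q%:R `^ (- lambda + delta).
  rewrite -{1}(powRr1 (ltW q0')) -gt0_powRD //; congr (_ `^ _); ring.
have xp j : `|x 0 j - (p j)%:~R / q%:R| <= q%:R `^ (- (lambda + 1 - delta)).
  have -> : x 0 j - (p j)%:~R / q%:R = (q%:R * x 0 j - (p j)%:~R) / q%:R.
    by field; rewrite gt_eqF.
  by rewrite normrM normfV (gtr0_norm q0') ler_pdivrMr // [leRHS]mulrC Ek.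
pose Q := (\big[lcmn/1]_j b j)%N.
exists q, Q.
have gq j : (g j %| q)%N by exact: dvdn_gcdr.
have g0 j : (0 < g j)%N by rewrite gcdn_gt0 q0 orbT.
have b0 j : (0 < b j)%N by rewrite divn_gt0; [exact: dvdn_leq|exact: g0].
have Q0 : (0 < Q)%N.
  rewrite /Q; apply: (big_ind (fun m => 0 < m)%N) => // m k m0 k0.
  by rewrite lcmn_gt0 m0.
split=> //; first by apply: leq_trans Mq; exact: leq_maxl.
  apply: dvdn_leq; first by rewrite muln_gt0 q0.
  rewrite /Q; apply: (big_ind (fun m => m ^ d %| q * L)%N).
  - by rewrite exp1n dvd1n.
  - by move=> m k; exact: lcmn_exp_dvd.
  move=> j _; have [dg1 dgd] := Pd j.
  apply: dvdn_trans (dvdn_exp2l _ dgd) _.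
  apply: (@dvdn_trans (q * `|lead_coef (P j)| ^ degree (P j))%N); last first.
    by rewrite dvdn_mul // /L (bigD1 j) //= dvdn_mulr.
  apply: (@denom_dvd R _ _ _ (n j)) => //.
  have xp1 : `|x 0 j - (p j)%:~R / q%:R| <= 1.
    apply: (le_trans (xp j)); rewrite -[leRHS](powRr0 q%:R) ler_powR //.
    have := Hd0 j; have : 1 <= (degree (P j))%:R :> R by rewrite ler1n.
    lra.
  have H1 := HK j _ xp1.
  have H2 : `|q%:R * (map_poly intr (P j)).[(p j)%:~R / q%:R] - (n j)%:~R| <=
      (K + 1) * q%:R `^ (- lambda + delta).
    have -> : q%:R * (map_poly intr (P j)).[(p j)%:~R / q%:R] - (n j)%:~R =
      (q%:R * (map_poly intr (P j)).[x 0 j] - (n j)%:~R) -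
      q%:R * ((map_poly intr (P j)).[x 0 j] - (map_poly intr (P j)).[(p j)%:~R / q%:R]) by ring.
    apply: (le_trans (ler_normB _ _)); rewrite addrC mulrDl mul1r; apply: lerD => //.
    rewrite normrM (gtr0_norm q0') -Ek mulrCA ler_pM2l //; apply: (le_trans H1).
    by rewrite ler_wpM2l // (le_trans ler01).
  apply: (@le_lt_trans _ _ ((K + 1) * q%:R `^ (- d0))).
    apply: (@le_trans _ _ ((K + 1) * q%:R `^ (- lambda + delta) * q%:R ^+ (degree (P j)).-1)).
      by rewrite ler_wpM2r // exprn_ge0.
    rewrite -mulrA ler_wpM2l //; first by rewrite addr_ge0 // (le_trans ler01).
    rewrite -powR_mulrn // -gt0_powRD // ler_powR // -subn1 natrB //.
    by have := Hd0 j; lra.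
  rewrite powRN ltr_pdivrMr ?powR_gt0 // mul1r; apply: lt_le_trans Kq; lra.
move=> j; have bQ : (b j %| Q)%N by rewrite /Q (bigD1 j) //= dvdn_lcml.
have [a aE] : exists a : int, Q%:R * ((p j)%:~R / q%:R) = a%:~R :> R.
  have /dvdzP[a pE] : ((g j)%:Z %| p j)%Z by rewrite dvdzE /= dvdn_gcdl.
  have /dvdnP[m QE] := bQ.
  have qE : q = (b j * g j)%N by rewrite divnK.
  exists (m%:Z * a); rewrite {1}pE QE {1}qE !intrM !natrM -!pmulrn.
  have g0' : (g j)%:R != 0 :> R by rewrite pnatr_eq0 -lt0n g0.
  have b0' : (b j)%:R != 0 :> R by rewrite pnatr_eq0 -lt0n.
  by field; rewrite g0' b0'.
exists a; rewrite -aE -mulrBr normrM ger0_norm // ler_wpM2l //.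
Qed.

(** The multipliers [Q] of [common_denominator] satisfy [q >= Q ^ d / L], which turns
    the exponent [lambda + 1] in [q] into [d * (lambda + 1)] in [Q]. If they stay
    bounded, the coordinates of [x] are limits of fractions of bounded
    denominator, hence rational, and all exponents are reached. *)
Lemma approx_graph_inv (R : realType) (s : nat) (P : 'I_s -> {poly int}) (d : nat)
    (lambda : R) (x : 'rV[R]_s) :
  (0 < d)%N -> (forall i, d <= degree (P i))%N ->
  0 < lambda -> (forall i, (degree (P i))%:R - 1 < lambda) ->
  approx_set (s + s) lambda (graph_point P x) ->
  approx_set s (d%:R * lambda + d%:R - 1) x.
Proof.
move=> d0 dP l0 Pl xA; apply/approx_setP => eps eps0 N.
have dP' i : (1 <= degree (P i))%N /\ (d <= degree (P i))%N.
  by split=> //; apply: leq_trans (dP i).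
have [L L0 [delta0 delta00 H]] := common_denominator dP' Pl xA.
have d1 : 1 <= d%:R :> R by rewrite ler1n.
have d0' : 0 < d%:R :> R by rewrite ltr0n.
pose delta := Num.min delta0 (Num.min 1 (eps / (2 * d%:R))).
have de0 : 0 < delta by rewrite !lt_min delta00 ltr01 /= divr_gt0 // mulr_gt0.
have de1 : delta <= delta0 by rewrite ge_min lexx.
have de2 : delta <= 1 by rewrite /delta minCA ge_min lexx.
have de3 : d%:R * delta <= eps / 2.
  have : delta <= eps / (2 * d%:R) by rewrite /delta minA ge_min lexx orbT.
  rewrite ler_pdivlMr ?mulr_gt0 //; lra.
have {H de1} H := H delta de0 de1.
have kap0 : 0 < lambda + 1 - delta by lra.
have [M1 HM1] := natr_powR_large (L%:R `^ (lambda + 1 - delta)) (divr_gt0 eps0 (ltr0Sn R 1)).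
pose N2 := maxn N M1.
(* Either a large multiplier exists, or all multipliers divide [N2`!]. *)
have [[q [Q [q0 Q0 QL Hx QN]]]|small] := pselect (exists q Q : nat,
    [/\ (0 < q)%N, (0 < Q)%N, (Q ^ d <= q * L)%N,
     (forall j, exists a : int, `|Q%:R * x 0 j - a%:~R| <= Q%:R * q%:R `^ (- (lambda + 1 - delta))) &
     (N2 <= Q)%N]).
  exists Q; split=> //; first by apply: leq_trans QN; exact: leq_maxl.
  move=> j; have [a Ha] := Hx j; exists a; apply: (le_trans Ha).
  have Q0' : 0 < Q%:R :> R by rewrite ltr0n.
  have L0' : 0 < L%:R :> R by rewrite ltr0n.
  have QLq : Q%:R ^+ d / L%:R <= q%:R :> R.
    by rewrite ler_pdivrMr // -natrX -natrM ler_nat.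
  apply: (@le_trans _ _ (Q%:R * (Q%:R ^+ d / L%:R) `^ (- (lambda + 1 - delta)))).
    by rewrite ler_wpM2l // ler_powRN2r ?(ltW kap0) // divr_gt0 // exprn_gt0.
  have -> : (Q%:R ^+ d / L%:R) `^ (- (lambda + 1 - delta)) =
     Q%:R `^ (- (d%:R * (lambda + 1 - delta))) * L%:R `^ (lambda + 1 - delta).
    rewrite powRM ?exprn_ge0 ?invr_ge0 // -powR_mulrn // -powRrM mulrN; congr (_ * _).
    by rewrite -powR_inv1 // -powRrM mulN1r opprK.
  apply: (@le_trans _ _ (Q%:R * (Q%:R `^ (- (d%:R * (lambda + 1 - delta))) * Q%:R `^ (eps / 2)))).
    rewrite ler_pM2l // ler_wpM2l ?powR_ge0 //; apply: HM1.
    by apply: leq_trans QN; exact: leq_maxr.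
  rewrite -{1}(powRr1 (ltW Q0')) -!gt0_powRD // ler_powR ?ler1n //; lra.
pose F := (N2`!)%N.
have F0 : (0 < F)%N by exact: fact_gt0.
have F0' : 0 < F%:R :> R by rewrite ltr0n.
have Fx j : exists a : int, F%:R * x 0 j = a%:~R.
  suff /dist_int_leP[a] : dist_int (F%:R * x 0 j) <= 0.
    by rewrite normr_le0 subr_eq0 => /eqP; exists a.
  apply/ler_addgt0Pr => h h0; rewrite add0r.
  have [q1 Hq1] := natr_powR_large (F%:R / h) kap0.
  have [q [Q [Mq Q0 QL Hx]]] := H (maxn 1 q1).
  have q0 : (0 < q)%N by apply: leq_trans Mq; exact: leq_maxl.
  have QN : (Q < N2)%N.
    by rewrite ltnNge; apply/negP => QN; apply: small; exists q, Q.
  have /dvdnP[m FE] : (Q %| F)%N by apply: dvdn_fact; rewrite Q0 ltnW.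
  apply/dist_int_leP; have [a Ha] := Hx j; exists (m%:Z * a).
  have -> : F%:R * x 0 j - (m%:Z * a)%:~R = m%:R * (Q%:R * x 0 j - a%:~R).
    by rewrite FE intrM natrM -pmulrn; ring.
  rewrite normrM ger0_norm //; apply: (@le_trans _ _ (m%:R * (Q%:R * q%:R `^ (- (lambda + 1 - delta))))).
    by rewrite ler_wpM2l.
  rewrite mulrA -natrM -FE powRN ler_pdivrMr ?powR_gt0 ?ltr0n //.
  rewrite mulrC -ler_pdivrMr //; apply/Hq1/(leq_trans _ Mq)/leq_maxr.
exists (F * maxn 1 N)%N; split.
- by rewrite muln_gt0 F0 leq_max.
- by apply: (leq_trans (leq_maxr 1 N)); rewrite leq_pmull.
move=> j; have [a aE] := Fx j; exists (a * (maxn 1 N)%:Z).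
by rewrite natrM mulrAC aE intrM -pmulrn subrr normr0 powR_ge0.
Qed.

Lemma graph_point_lipschitz (R : realType) (s : nat) (P : 'I_s -> {poly int}) :
  exists (C e : R), [/\ 0 <= C, 0 <= e & forall (B d : R) (x y : 'rV[R]_s), 1 <= B -> 0 <= d ->
    (forall j, `|x 0 j| <= B /\ `|y 0 j| <= B /\ `|x 0 j - y 0 j| <= d) ->
    `|graph_point P x - graph_point P y| <= C * B `^ e * d].
Proof.
have [C [e [C1 H]]] := polys_lipschitz (fun i => map_poly intr (P i) : {poly R}).
have C0 : 0 <= C by rewrite (le_trans ler01).
exists C, e%:R; split=> // B d x y B1 d0 xy.
have B0 : 0 <= B by rewrite (le_trans ler01).
have CB : 1 <= C * B ^+ e by rewrite mulr_ege1 // exprn_ege1.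
rewrite powR_mulrn //; apply: norm_le_coord => [|j].
  by rewrite mulr_ge0 // (le_trans ler01).
case: (split_ordP j) => k ->; have [xB [yB xyd]] := xy k; rewrite [X in `|X|]mxE [X in _ + X]mxE.
  by rewrite !row_mxEl; apply: (le_trans xyd); rewrite ler_peMl.
rewrite !row_mxEr [X in `|X - _|]mxE [X in `|_ - X|]mxE; apply: (le_trans (H k B _ _ B1 xB yB)).
by rewrite ler_wpM2l // (le_trans ler01).
Qed.

Lemma bigminn_le (I : eqType) (r : seq I) (m : nat) (F : I -> nat) (i : I) :
  i \in r -> (\big[minn/m]_(j <- r) F j <= F i)%N.
Proof.
elim: r => // j r IH; rewrite inE big_cons geq_min => /predU1P[->|/IH ->].
  by rewrite leqnn.
by rewrite orbT.
Qed.

Unset Implicit Arguments.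

Theorem corollary2p10 (R : realType) (s : nat) (hs : (1 <= s)%N)
    (P : 'I_s -> {poly int}) (hP : forall i, (1 <= degree (P i))%N) :
  let d := min_degree P in
  let d' := max_degree P in
  let M := poly_manifold R P in
  (forall lambda : R, Num.max (d'%:R - 1) 1 < lambda ->
    [/\ approx_set s (d'%:R * lambda + d'%:R - 1)
          `<=` @proj_first R s s @` (approx_set (s + s) lambda `&` M),
        @proj_first R s s @` (approx_set (s + s) lambda `&` M)
          `<=` approx_set s (d%:R * lambda + d%:R - 1),
        (((s%:R + 1) / (d'%:R * (lambda + 1)))%:E
          <= hausdorff_dim (approx_set (s + s) lambda `&` M))%E &
        (hausdorff_dim (approx_set (s + s) lambda `&` M)
          <= ((s%:R + 1) / (d%:R * (lambda + 1)))%:E)%E])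
  /\
  (d' = d ->
    forall lambda : R, Num.max (d%:R - 1) 1 < lambda ->
      @proj_first R s s @` (approx_set (s + s) lambda `&` M)
        = approx_set s (d%:R * lambda + d%:R - 1)
      /\ hausdorff_dim (approx_set (s + s) lambda `&` M)
        = ((s%:R + 1) / (d%:R * (lambda + 1)))%:E).
Proof.
move=> d d' M.
have d'P i : (degree (P i) <= d')%N by exact: (leq_bigmax i).
have dP i : (d <= degree (P i))%N by apply: bigminn_le; rewrite mem_index_enum.
have d'0 : (0 < d')%N by apply: leq_trans (d'P (Ordinal hs)).
have d0 : (0 < d)%N.
  by apply: (big_ind (fun n => 0 < n)%N) => // m n m0 n0; rewrite leq_min m0.
have main (lambda : R) : Num.max (d'%:R - 1) 1 < lambda ->
    [/\ approx_set s (d'%:R * lambda + d'%:R - 1)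
          `<=` @proj_first R s s @` (approx_set (s + s) lambda `&` M),
        @proj_first R s s @` (approx_set (s + s) lambda `&` M)
          `<=` approx_set s (d%:R * lambda + d%:R - 1),
        (((s%:R + 1) / (d'%:R * (lambda + 1)))%:E
          <= hausdorff_dim (approx_set (s + s) lambda `&` M))%E &
        (hausdorff_dim (approx_set (s + s) lambda `&` M)
          <= ((s%:R + 1) / (d%:R * (lambda + 1)))%:E)%E].
  rewrite gt_max => /andP[ld l1].
  have l0 : 0 < lambda by rewrite (lt_trans ltr01).
  have Pl i : (degree (P i))%:R - 1 < lambda.
    by apply: le_lt_trans ld; rewrite lerD2r ler_nat.
  have sub1 : approx_set s (d'%:R * lambda + d'%:R - 1)
      `<=` @proj_first R s s @` (approx_set (s + s) lambda `&` M).
    move=> x xA; exists (graph_point P x); last by rewrite /proj_first row_mxKl.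
    by split; [exact: approx_graph xA|exists x].
  have sub2 x : approx_set (s + s) lambda (graph_point P x) ->
      approx_set s (d%:R * lambda + d%:R - 1) x by exact: approx_graph_inv.
  have d1 (n : nat) : (0 < n)%N -> lambda <= n%:R * lambda + n%:R - 1.
    move=> n0; have n1 : 1 <= n%:R :> R by rewrite ler1n.
    have : 1 * lambda <= n%:R * lambda by rewrite ler_pM2r.
    lra.
  have dE (n : nat) : n%:R * (lambda + 1) = n%:R * lambda + n%:R - 1 + 1 by ring.
  split=> //.
  - move=> _ [z [zA [x _ xE]] <-]; rewrite -xE /proj_first row_mxKl.
    by apply: sub2; rewrite /graph_point xE.
  - by rewrite dE; apply: hausdorff_dim_ge sub1 => //; apply: lt_le_trans l1 (d1 _ d'0).
  have [C [e [C0 e0 HC]]] := @graph_point_lipschitz R s P.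
  rewrite dE; apply: hausdorff_dim_le C0 e0 HC _; first exact: lt_le_trans l0 (d1 _ d0).
  by move=> z [zA [x _ xE]]; exists x => //; apply: sub2; rewrite /graph_point xE.
split=> // dd lambda; rewrite -dd => /main[]; rewrite -dd => s1 s2 h1 h2; split.
  by apply/seteqP; split.
by apply/eqP; rewrite eq_le h1 h2.
Qed.
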